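(* Let $G=S_n$ and $H=S_b\wr S_a$ (the stabiliser of a partition of $\{1,\dots,n\}$ into $a$ blocks of size $b$), where $n=ab$, $a\geqslant b\geqslant 2$ and $(a,b)\neq(2,2)$. Then $b(G,H)=4$ if $(a,b)=(3,2)$; $b(G,H)=2$ if $b\geqslant 3$ and $a\geqslant \max\{b+3,8\}$; and $b(G,H)=3$ otherwise.
   Context: For a subgroup $H\leqslant G$, $H_G=\bigcap_{g\in G}H^g$ is the core of $H$, and $b(G,H)=\min\{|S| : S\subseteq G,\ \bigcap_{g\in S}H^g=H_G\}$. Equivalently here, $b(G,H)$ is the minimal number of partitions of $\{1,\dots,n\}$ into $a$ parts of size $b$ whose common stabiliser in $S_n$ is trivial. *)

(* Defs.v *)
From mathcomp Require Import all_boot all_fingroup.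
Set Implicit Arguments. Unset Strict Implicit. Unset Printing Implicit Defensive.

Local Open Scope group_scope.

Definition core_in (gT : finGroupType) (G H : {set gT}) : {set gT} :=
  \bigcap_(g in G) (H :^ g).

(* Base size b(G,H) = min { |S| : S \subseteq G, \bigcap_(g in S) H^g = H_G }.
   S = G always qualifies, so #|G| is a valid starting value of the min. *)
Definition base_size (gT : finGroupType) (G H : {set gT}) : nat :=
  \big[minn/#|G|]_(S : {set gT} | (S \subset G) && (\bigcap_(g in S) (H :^ g) == core_in G H))
     #|S|.

Definition std_block (a b : nat) (j : 'I_a) : {set 'I_(a * b)} :=
  [set i : 'I_(a * b) | (i %/ b)%N == j].

Definition std_partition (a b : nat) : {set {set 'I_(a * b)}} :=
  [set std_block b j | j : 'I_a].

Definition wreath_stab (a b : nat) : {set {perm 'I_(a * b)}} :=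
  [set s : {perm 'I_(a * b)} |
     [set (s @: B) | B : {set 'I_(a * b)} in std_partition a b] == std_partition a b].

(* Main.v *)
(** A conjugate of [H] is the stabiliser of a partition into [a] blocks of size [b], so the base
    size is the least number of such partitions with trivial common stabiliser.

    Two partitions with trivial common stabiliser amount to a [b]-regular bipartite graph on
    [a + a] vertices (points are edges, blocks are vertices) without nontrivial side-preserving
    automorphism.  Bipartite complementation keeps the automorphisms and turns [b] into [a - b].
    Degrees 0 and 1 are impossible for trivial reasons and degree 2 because
    [(2a)! < (2 ^ a a!) ^ 2] forces the stabilisers of two partitions into pairs to intersect.
    For degree 3 and [a = 6, 7] one enumerates the adjacency matrices that are lexicographically
    maximal under row and column permutations, and finds a symmetry of each of them.
    If [a >= 8] and [3 <= d <= a / 2], one switch of edges makes the circulant graph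
    [i ~ i, ..., i + d - 1] asymmetric (for [(a, d) = (8, 3)] one needs two switches): the cycle
    formed by the pairs of rows whose neighbourhoods differ in one vertex breaks up into paths and
    small pieces, whose relative position leaves no freedom.

    Three partitions always suffice when [b >= 3]: to the rows and columns of a circulant
    arrangement add the row partition with one point of each row moved to the next row; the moved
    points are chosen to lie in different columns, except for the first two. *)
Require Import Defs.
From mathcomp Require Import all_boot all_fingroup.
From mathcomp Require Import zify.
Set Implicit Arguments. Unset Strict Implicit. Unset Printing Implicit Defensive.

(** * Partitions as labellings *)

Section Stab.
Variables (T : finType) (a : nat).
Implicit Types (f : T -> 'I_a) (s : {perm T}).

(** A labelling stands for the partition into its fibres; [u] is the permutation of blocks that [s]
    induces. *)
Definition stab f s := exists u : {perm 'I_a}, forall x, f (s x) = u (f x).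

Definition balanced b f := forall j, #|[set x | f x == j]| = b.

Lemma stabM f s t : stab f s -> stab f t -> stab f (s * t)%g.
Proof.
by case=> u fu [v fv]; exists (u * v)%g => x; rewrite !permM fv fu.
Qed.

(** The induced map on labels is onto because [s] is, and a surjection of a finite set onto itself
    is a permutation. *)
Lemma stab_eq f s : (forall j, exists x, f x = j) ->
  (forall x y, f x = f y -> f (s x) = f (s y)) -> stab f s.
Proof.
move=> surj fs.
have [r fr] := fin_all_exists surj; pose g j := f (s (r j)).
have gE x : g (f x) = f (s x) by apply: fs; rewrite fr.
have g_surj j : exists i, g i = j.
  by have [x <-] := surj j; exists (f (s^-1%g x)); rewrite gE permKV.
have g_inj : injective g.
  have : #|codom g| = #|'I_a|.
    by apply: eq_card => j; rewrite [RHS]inE; have [i <-] := g_surj j; rewrite codom_f.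
  by move/eqP/image_injP => g_inj x y /g_inj; apply.
by exists (perm g_inj) => x; rewrite permE gE.
Qed.

Lemma balanced_surj b f : (0 < b)%N -> balanced b f -> forall j, exists x, f x = j.
Proof.
move=> b_gt0 bf j; have : (0 < #|[set x | f x == j]|)%N by rewrite bf.
by rewrite card_gt0 => /set0Pn [x]; rewrite inE => /eqP; exists x.
Qed.

End Stab.

Lemma bigmin_leq (I : eqType) (r : seq I) (P : pred I) (F : I -> nat) x i :
  i \in r -> P i -> (\big[minn/x]_(j <- r | P j) F j <= F i)%N.
Proof.
move=> + Pi; elim: r => // j r IHr; rewrite inE big_cons => /orP[/eqP<-|/IHr le_i].
  by rewrite Pi geq_minl.
by case: ifP => // _; rewrite geq_min le_i orbT.
Qed.

(** * Base size in terms of labellings *)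

Section Interface.
Variables (a b : nat).
Local Notation pt := 'I_(a * b).

Lemma std_lt (x : pt) : (x %/ b < a)%N.
Proof. by case: x => x /= ltx; rewrite ltn_divLR //; case: b ltx => //; rewrite muln0. Qed.

Definition std (x : pt) : 'I_a := Ordinal (std_lt x).

Lemma in_std_block (j : 'I_a) (x : pt) : (x \in std_block b j) = (std x == j).
Proof. by rewrite inE. Qed.

Lemma std_balanced : balanced b std.
Proof.
move=> j; case: (posnP b) => [b0|b_gt0].
  transitivity 0%N => //; apply: eq_card0 => x; have := ltn_ord x.
  by rewrite [X in (_ < X)%N](_ : _ = 0)%N // b0 muln0.
have lt_pt (k : 'I_b) : (j * b + k < a * b)%N by have := ltn_ord k; have := ltn_ord j; nia.
have inj : injective (fun k => Ordinal (lt_pt k)).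
  by move=> k l /(congr1 val) /= /addnI /val_inj.
rewrite -[RHS]card_ord -(card_imset _ inj); apply: eq_card => x.
rewrite !inE; apply/eqP/imsetP => [xj|[k _ ->]].
  exists (Ordinal (ltn_pmod x b_gt0)) => //; apply: val_inj => /=.
  by rewrite -xj /= -divn_eq.
by apply: val_inj; rewrite /= divnMDl // divn_small ?addn0.
Qed.

Hypothesis b_gt0 : (0 < b)%N.

Lemma std_surj j : exists x, std x = j.
Proof. exact: balanced_surj std_balanced j. Qed.

Lemma mem_wreath (s : {perm pt}) : reflect (stab std s) (s \in wreath_stab a b).
Proof.
rewrite inE; apply: (iffP eqP) => [imP|[u su]].
  apply: stab_eq => [|x y xy]; first exact: std_surj.
  have : s @: std_block b (std x) \in std_partition a b.
    by rewrite -imP; apply/imset_f/imset_f.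
  case/imsetP=> j _ sj.
  have h z : std z = std x -> std (s z) = j.
    by move=> zx; apply/eqP; rewrite -in_std_block -sj; apply: imset_f; rewrite in_std_block zx.
  by rewrite !h.
have sB j : s @: std_block b j = std_block b (u j).
  apply/setP => x; rewrite in_std_block; apply/imsetP/eqP => [[y] |xj].
    by rewrite in_std_block => /eqP <- ->.
  exists (s^-1%g x); last by rewrite permKV.
  by rewrite in_std_block -(inj_eq (@perm_inj _ u)) -su permKV xj.
apply/setP => B; apply/imsetP/imsetP => [[_ /imsetP[j _ ->] ->]|[j _ ->]].
  by exists (u j).
by exists (std_block b (u^-1%g j)); rewrite ?imset_f // sB permKV.
Qed.

(* The labelling whose fibres are the blocks of the partition stabilised by [H :^ g]. *)
Definition lab (g : {perm pt}) (x : pt) : 'I_a := std (g^-1%g x).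

Lemma mem_conj_wreath (g s : {perm pt}) :
  reflect (stab (lab g) s) (s \in wreath_stab a b :^ g)%g.
Proof.
rewrite mem_conjg; apply: (iffP (mem_wreath _)) => -[u su]; exists u => x.
  by have := su (g^-1%g x); rewrite /lab conjgE !permM invgK permKV.
by have := su (g x); rewrite /lab permK => <-; rewrite conjgE !permM invgK.
Qed.

Lemma lab_balanced g : balanced b (lab g).
Proof.
move=> j; transitivity #|[set x | std x == j]|; last exact: std_balanced.
rewrite -[RHS](card_imset _ (@perm_inj _ g)).
apply: eq_card => x; rewrite !inE; apply/idP/imsetP => [xj|[y]].
  by exists (g^-1%g x); rewrite ?permKV // inE.
by rewrite inE /lab => yj ->; rewrite permK.
Qed.

(** Numbering the points within each fibre sends [x] to [f x * b] plus its rank, so every balanced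
    labelling is the standard one read through an injection. *)
Lemma ex_lab (T : finType) (f : T -> 'I_a) :
  balanced b f -> exists2 h : T -> pt, injective h & forall x, std (h x) = f x.
Proof.
move=> bf.
have szf j : size (enum [set y | f y == j]) = b by rewrite -cardE bf.
have ltf x : (f x * b + index x (enum [set y | f y == f x]) < a * b)%N.
  have := ltn_ord (f x).
  have : (index x (enum [set y | f y == f x]) < b)%N.
    by rewrite -[X in (_ < X)%N](szf (f x)) index_mem mem_enum inE.
  nia.
have idx x : (index x (enum [set y | f y == f x]) < b)%N.
  by rewrite -[X in (_ < X)%N](szf (f x)) index_mem mem_enum inE.
have stdh x : std (Ordinal (ltf x)) = f x.
  by apply: val_inj; rewrite /= divnMDl // divn_small ?addn0.
exists (fun x => Ordinal (ltf x)) => // x y hxy.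
have fxy : f x = f y by rewrite -stdh hxy stdh.
move/(congr1 val): hxy; rewrite /= fxy => /addnI /(congr1 (nth x (enum [set z | f z == f y]))).
by rewrite !nth_index // mem_enum inE // fxy.
Qed.

(** The core lies in every intersection of conjugates, and the identity lies in every conjugate. *)
Lemma core_trivial (A : {set {perm pt}}) :
  (\bigcap_(g in A) (wreath_stab a b :^ g) = 1)%g ->
  core_in [set: {perm pt}] (wreath_stab a b) = 1%g.
Proof.
move=> A1; apply/eqP; rewrite eqEsubset; apply/andP; split.
  by rewrite -A1; apply/bigcapsP => g _; apply: bigcap_inf; rewrite inE.
rewrite sub1set; apply/bigcapP => g _; apply/mem_conj_wreath; exists 1%g => x.
by rewrite !perm1.
Qed.

Lemma bigcap_trivial (A : {set {perm pt}}) :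
  (forall s, (forall g, g \in A -> stab (lab g) s) -> s = 1%g) ->
  (\bigcap_(g in A) (wreath_stab a b :^ g) = 1)%g.
Proof.
move=> A1; apply/setP => s; rewrite inE; apply/bigcapP/eqP => [sA|-> g _].
  by apply: A1 => g /sA /mem_conj_wreath.
by apply/mem_conj_wreath; exists 1%g => x; rewrite !perm1.
Qed.

Lemma base_size_le (gs : seq {perm pt}) :
  (forall s, (forall g, g \in gs -> stab (lab g) s) -> s = 1%g) ->
  (base_size [set: {perm pt}] (wreath_stab a b) <= size gs)%N.
Proof.
move=> gs1; have cap1 : (\bigcap_(g in [set:: gs]) (wreath_stab a b :^ g) = 1)%g.
  apply: bigcap_trivial => s sA; apply: gs1 => g ggs; apply: sA.
  by rewrite inE.
(* Repetitions in [gs] only make the set smaller. *)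
apply: (@leq_trans #|[set:: gs]|); last first.
  by rewrite cardsE; apply: card_size.
apply: bigmin_leq; first by rewrite mem_index_enum.
by rewrite subsetT (core_trivial cap1) cap1 eqxx.
Qed.

(** [gs0] makes the core trivial. A qualifying set of at most [k] elements is padded with the
    identity to a list of length exactly [k]; the bound on [k] takes care of the default value of
    the minimum. *)
Lemma base_size_gt k (gs0 : seq {perm pt}) :
  (forall s, (forall g, g \in gs0 -> stab (lab g) s) -> s = 1%g) ->
  (k < #|{perm pt}|)%N ->
  (forall gs : seq {perm pt}, size gs = k ->
     ~ forall s, (forall g, g \in gs -> stab (lab g) s) -> s = 1%g) ->
  (k < base_size [set: {perm pt}] (wreath_stab a b))%N.
Proof.
move=> gs01 ltk kP; have core1 := core_trivial (@bigcap_trivial [set:: gs0] _).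
rewrite /base_size {}core1 => [|s sA]; last first.
  by apply: gs01 => g ggs; apply: sA; rewrite inE.
rewrite -cardsT in ltk; apply: (big_ind (fun m => (k < m)%N)) => // [m n|A].
  by rewrite leq_min => -> ->.
case/andP=> _ /eqP A1; rewrite ltnNge; apply/negP => leA.
apply: (kP (enum A ++ nseq (k - #|A|) 1%g)) => [|s sA].
  by rewrite size_cat size_nseq -cardE subnKC.
suff : s \in \bigcap_(g in A) (wreath_stab a b :^ g)%g by rewrite A1 inE => /eqP.
apply/bigcapP => g gA; apply/mem_conj_wreath/sA.
by rewrite mem_cat mem_enum gA.
Qed.

End Interface.


(** * Families of labellings on an arbitrary point set *)

Section Labellings.
Variables (T : finType) (a b : nat).
Implicit Types (f : T -> 'I_a) (fs : seq (T -> 'I_a)) (s : {perm T}).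

Fixpoint stabs fs s : Prop :=
  if fs is f :: fs' then stab f s /\ stabs fs' s else True.

Fixpoint all_balanced fs : Prop :=
  if fs is f :: fs' then balanced b f /\ all_balanced fs' else True.

Definition rigid fs := forall s, stabs fs s -> s = 1%g.

Lemma balanced_card f : balanced b f -> #|T| = (a * b)%N.
Proof.
move=> bf; rewrite -cardsT -sum1_card (partition_big f predT) //=.
rewrite (eq_bigr (fun=> b)) => [|j _]; first by rewrite sum_nat_const card_ord.
by rewrite -(bf j) -sum1_card; apply: eq_bigl => x; rewrite !inE.
Qed.

(** Transports a family to the standard points, so that grids and edge sets may serve as points. *)
Lemma rigid_perms fs : (0 < b)%N -> #|T| = (a * b)%N -> all_balanced fs -> rigid fs ->
  exists2 gs : seq {perm 'I_(a * b)}, size gs = size fs &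
    forall s : {perm 'I_(a * b)}, (forall g, g \in gs -> stab (lab g) s) -> s = 1%g.
Proof.
move=> b_gt0 cardT bfs rfs.
pose h (x : T) := cast_ord cardT (enum_rank x).
pose k y : T := enum_val (cast_ord (esym cardT) y).
have hK : cancel h k by move=> x; rewrite /k cast_ordK enum_rankK.
have kK : cancel k h by move=> y; rewrite /h enum_valK cast_ordKV.
have {bfs} [gs szgs gsP] : exists2 gs : seq {perm 'I_(a * b)}, size gs = size fs &
    forall s : {perm 'I_(a * b)}, (forall g, g \in gs -> stab (lab g) s) ->
    forall s' : {perm T}, (forall x, s' x = k (s (h x))) -> stabs fs s'.
  elim: fs {rfs} bfs => [|f fs IH] /=; first by exists [::].
  case=> bf /IH [gs szgs gsP]; have [hf hf_inj stdhf] := ex_lab b_gt0 bf.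
  have inj : injective (hf \o k) by apply: inj_comp hf_inj (can_inj kK).
  (* [lab] reads labels through the inverse, so the conjugating element is the inverse of the map
     onto the standard positions. *)
  exists ((perm inj)^-1%g :: gs) => [|s sgs s' s'E]; first by rewrite /= szgs.
  split; last by apply: gsP s'E => g ggs; apply: sgs; rewrite inE ggs orbT.
  have [u su] := sgs _ (mem_head _ _); exists u => x.
  have := su (h x); rewrite /lab invgK !permE /= !stdhf hK => <-.
  by rewrite s'E.
exists gs => // s sgs.
have s'_inj : injective (fun x => k (s (h x))).
  by move=> x y /(can_inj kK) /perm_inj /(can_inj hK).
have /rfs s'1 : stabs fs (perm s'_inj) by apply: gsP sgs _ _ => x; rewrite permE.
apply/permP => y; have := congr1 (fun t : {perm T} => t (k y)) s'1.
by rewrite permE perm1 /= kK => /(can_inj kK) ->; rewrite perm1.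
Qed.

Lemma base_size_le_rigid fs : (0 < b)%N -> #|T| = (a * b)%N -> all_balanced fs -> rigid fs ->
  (base_size [set: {perm 'I_(a * b)}] (wreath_stab a b) <= size fs)%N.
Proof.
move=> b_gt0 cT bfs rfs; have [gs <- gsP] := rigid_perms b_gt0 cT bfs rfs.
exact: base_size_le.
Qed.

End Labellings.

Lemma base_size_gt_rigid (T : finType) a b (fs : seq (T -> 'I_a)) k :
  (0 < b)%N -> #|T| = (a * b)%N -> all_balanced b fs -> rigid fs ->
  (k < (a * b)`!)%N ->
  (forall F : seq ('I_(a * b) -> 'I_a), size F = k -> all_balanced b F -> ~ rigid F) ->
  (k < base_size [set: {perm 'I_(a * b)}] (wreath_stab a b))%N.
Proof.
move=> b_gt0 cT bfs rfs ltk kP; have [gs0 _ gs0P] := rigid_perms b_gt0 cT bfs rfs.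
apply: (base_size_gt b_gt0 gs0P) => [|gs szgs gsP]; first by rewrite card_Sn.
apply: (kP [seq (lab g) | g <- gs]); first by rewrite size_map.
  by elim: gs {szgs gsP} => //= g gs IH; split=> //; apply: lab_balanced.
move=> s sgs; apply: gsP; elim: gs sgs {szgs} => // g gs IH /= [sg sgs] g'.
by rewrite inE => /orP[/eqP-> //|]; apply: IH.
Qed.

(** * Two partitions as a bipartite graph *)

Section Relations.
Variable a : nat.
Implicit Types (e : rel 'I_a) (u v : {perm 'I_a}).

Definition regular d e :=
  (forall i, #|[set j | e i j]| = d) /\ (forall j, #|[set i | e i j]| = d).

Definition aut e u v := forall i j, e (u i) (v j) = e i j.

Definition asym e := forall u v, aut e u v -> u = 1%g /\ v = 1%g.

Lemma regular_compl d e : regular d e -> regular (a - d) (fun i j => ~~ e i j).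
Proof.
case=> re ce; split=> [i|j]; [rewrite -[in RHS](re i)|rewrite -[in RHS](ce j)].
  by rewrite cardsCs card_ord; congr (_ - _)%N; apply: eq_card => j; rewrite !inE negbK.
by rewrite cardsCs card_ord; congr (_ - _)%N; apply: eq_card => i; rewrite !inE negbK.
Qed.

Lemma asym_compl e : asym e -> asym (fun i j => ~~ e i j).
Proof. by move=> ase u v uv; apply: ase => i j; apply: negb_inj; apply: uv. Qed.

(** Edges play the role of points; their two endpoints give the two partitions. *)
Definition edge e := {x : 'I_a * 'I_a | e x.1 x.2}.
Definition efst e (x : edge e) := (val x).1.
Definition esnd e (x : edge e) := (val x).2.

Lemma edge_inj e (x y : edge e) : efst x = efst y -> esnd x = esnd y -> x = y.
Proof.
move=> xy1 xy2; apply: val_inj; move: xy1 xy2; rewrite /efst /esnd.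
by case: (val x) (val y) => [? ?] [? ?] /= -> ->.
Qed.

Lemma efst_balanced d e : regular d e -> balanced d (@efst e).
Proof.
case=> re _ i; rewrite -(re i).
have inj : {in [set x : edge e | efst x == i] &, injective (@esnd e)}.
  by move=> x y; rewrite !inE => /eqP xi /eqP yi; apply: edge_inj; rewrite xi yi.
rewrite -(card_in_imset inj); apply: eq_card => j; rewrite inE.
apply/imsetP/idP => [[x]|eij]; first by rewrite inE => /eqP <- ->; apply: (valP x).
by exists (exist _ (i, j) eij : edge e); rewrite ?inE.
Qed.

Lemma esnd_balanced d e : regular d e -> balanced d (@esnd e).
Proof.
case=> _ ce j; rewrite -(ce j).
have inj : {in [set x : edge e | esnd x == j] &, injective (@efst e)}.
  by move=> x y; rewrite !inE => /eqP xi /eqP yi xy; apply: edge_inj; rewrite // xi yi.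
rewrite -(card_in_imset inj); apply: eq_card => i; rewrite inE.
apply/imsetP/idP => [[x]|eij]; first by rewrite inE => /eqP <- ->; apply: (valP x).
by exists (exist _ (i, j) eij : edge e); rewrite ?inE.
Qed.

(** A permutation of the edges that respects both partitions is induced by an automorphism;
    conversely, positive degree puts every vertex on an edge, so an automorphism fixing all edges is
    trivial. *)
Lemma edge_rigid d e : (0 < d)%N -> regular d e ->
  asym e <-> rigid [:: @efst e; @esnd e].
Proof.
move=> d_gt0 reg; have [bf bs] := (efst_balanced reg, esnd_balanced reg).
split=> [ase s [[u su] [[v sv] _]]|rig u v uv].
  have uv i j : e i j -> e (u i) (v j).
    move=> eij; pose x : edge e := exist _ (i, j) eij.
    by have := valP (s x); rewrite -/(efst _) -/(esnd _) su sv.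
  (* The converse implication pulls the edge [(u i, v j)] back by [s^-1]. *)
  have : aut e u v.
    move=> i j; apply/idP/idP; last exact: uv.
    pose s' := s^-1%g => euv; pose x : edge e := exist _ (u i, v j) euv.
    have := valP (s' x); rewrite -/(efst _) -/(esnd _).
    have -> : efst (s' x) = i by apply: (@perm_inj _ u); rewrite -su permKV.
    by have -> : esnd (s' x) = j by apply: (@perm_inj _ v); rewrite -sv permKV.
  case/ase=> u1 v1; apply/permP => x; rewrite perm1.
  by apply: edge_inj; rewrite ?su ?sv ?u1 ?v1 perm1.
have eP (x : edge e) : e (u (efst x)) (v (esnd x)) by rewrite uv; apply: (valP x).
pose h (x : edge e) : edge e := exist _ (u (efst x), v (esnd x)) (eP x).
have h_inj : injective h.
  by move=> x y [] /perm_inj xy1 /perm_inj xy2; apply: edge_inj.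
have h1 : perm h_inj = 1%g.
  by apply: rig; split; [exists u|split=> //; exists v] => x; rewrite permE.
have hE x : h x = x by have := congr1 (fun t : {perm _} => t x) h1; rewrite permE perm1.
split; apply/permP => i; rewrite perm1.
  by have [x <-] := balanced_surj d_gt0 bf i; rewrite -{2}(hE x).
by have [x <-] := balanced_surj d_gt0 bs i; rewrite -{2}(hE x).
Qed.

(** Two points with the same pair of labels could be transposed, so in a rigid pair the points are
    the edges of a simple bipartite graph. *)
Lemma rigid2_asym (T : finType) d (f1 f2 : T -> 'I_a) :
  (0 < d)%N -> balanced d f1 -> balanced d f2 -> rigid [:: f1; f2] ->
  exists2 e, regular d e & asym e.
Proof.
move=> d_gt0 b1 b2 rig; pose e i j := [exists x, (f1 x == i) && (f2 x == j)].
have f_inj x y : f1 x = f1 y -> f2 x = f2 y -> x = y.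
  move=> xy1 xy2; have : tperm x y = 1%g.
    by apply: rig; split; [|split=> //]; exists 1%g => z; rewrite perm1; case: tpermP => [->|->|].
  by move/(congr1 (fun t : {perm T} => t x)); rewrite tpermL perm1.
have ef x : e (f1 x) (f2 x) by apply/existsP; exists x; rewrite !eqxx.
exists e.
  split=> [i|j].
    have inj : {in [set x | f1 x == i] &, injective f2}.
      by move=> x y; rewrite !inE => /eqP xi /eqP yi; apply: f_inj; rewrite xi yi.
    rewrite -(b1 i) -(card_in_imset inj); apply: eq_card => j; rewrite inE.
    apply/existsP/imsetP => [[x /andP[/eqP xi /eqP<-]]|[x]].
      by exists x; rewrite // inE xi.
    by rewrite inE => xi ->; exists x; rewrite xi /=.
  have inj : {in [set x | f2 x == j] &, injective f1}.
    by move=> x y; rewrite !inE => /eqP xi /eqP yi xy; apply: f_inj; rewrite // xi yi.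
  rewrite -(b2 j) -(card_in_imset inj); apply: eq_card => i; rewrite inE.
  apply/existsP/imsetP => [[x /andP[/eqP<- xj]]|[x]].
    by exists x; rewrite // inE.
  by rewrite inE => xj ->; exists x; rewrite xj eqxx.
move=> u v uv.
have [h hP] : exists h : T -> T, forall x, f1 (h x) = u (f1 x) /\ f2 (h x) = v (f2 x).
  apply: (fin_all_exists (P := fun x y => f1 y = u (f1 x) /\ f2 y = v (f2 x))) => x.
  have := ef x; rewrite -uv => /existsP[y /andP[/eqP y1 /eqP y2]].
  by exists y.
have h_inj : injective h.
  move=> x y xy; have [[x1 x2] [y1 y2]] := (hP x, hP y).
  by apply: f_inj; [apply: (@perm_inj _ u); rewrite -x1 -y1|
    apply: (@perm_inj _ v); rewrite -x2 -y2]; rewrite xy.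
have h1 : perm h_inj = 1%g.
  by apply: rig; split; [exists u|split=> //; exists v] => x; rewrite permE; case: (hP x).
have hE x : h x = x by have := congr1 (fun t : {perm _} => t x) h1; rewrite permE perm1.
split; apply/permP => i; rewrite perm1.
  by have [x <-] := balanced_surj d_gt0 b1 i; have [<- _] := hP x; rewrite hE.
by have [x <-] := balanced_surj d_gt0 b2 i; have [_ <-] := hP x; rewrite hE.
Qed.

End Relations.


(** * Graphs of degree at most two *)

Lemma not_asym0 a (e : rel 'I_a) : (1 < a)%N -> regular 0 e -> ~ asym e.
Proof.
move=> a_gt1 [re _] ase; have a_gt0 := ltnW a_gt1.
have e0 i j : e i j = false.
  by have /eqP := re i; rewrite cards_eq0 => /eqP/setP/(_ j); rewrite !inE.
have [|/permP/(_ (Ordinal a_gt0))] := ase (tperm (Ordinal a_gt0) (Ordinal a_gt1)) 1%g.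
  by move=> i j; rewrite !e0.
by rewrite tpermL perm1.
Qed.

(** The graph is a perfect matching, and two of its edges can be exchanged. *)
Lemma not_asym1 a (e : rel 'I_a) : (1 < a)%N -> regular 1 e -> ~ asym e.
Proof.
move=> a_gt1 [re ce] ase; have a_gt0 := ltnW a_gt1.
have [c cP] : exists c : 'I_a -> 'I_a, forall i, [set j | e i j] = [set c i].
  apply: (fin_all_exists (P := fun i k => [set j | e i j] = [set k])) => i.
  by have /eqP/cards1P[j ->] := re i; exists j.
have eE i j : e i j = (j == c i) by have /setP/(_ j) := cP i; rewrite !inE.
have c_inj : injective c.
  move=> i i' ii'; have /eqP/cards1P[k kP] := ce (c i).
  have /setP/(_ i) := kP; have /setP/(_ i') := kP.
  by rewrite !inE !eE ii' eqxx => /esym/eqP -> /esym/eqP.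
pose i := Ordinal a_gt0; pose i' := Ordinal a_gt1.
have [|/permP/(_ i)] := ase (tperm i i') (tperm (c i) (c i')).
  by move=> k l; rewrite !eE inj_tperm // (inj_eq (@perm_inj _ _)).
by rewrite tpermL perm1.
Qed.

(** From [n] to [n + 1] the left side gains the factor [(2n+2)(2n+1)] and the right side the larger
    [(2n+2)^2]. *)
Lemma fact_double_lt a : (0 < a)%N -> ((a * 2)`! < (2 ^ a * a`!) ^ 2)%N.
Proof.
case: a => // a _; elim: a => [|a IH] //.
have -> : ((a.+2 * 2)`! = (a.+1 * 2).+2 * ((a.+1 * 2).+1 * (a.+1 * 2)`!))%N by rewrite mulSn !factS.
rewrite [(2 ^ a.+2)%N]expnS [(a.+2)`!]factS.
move: IH; set p := (2 ^ a.+1)%N; set q := (a.+1)`!; set r := (_)`! => IH.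
have -> : ((2 * p * (a.+2 * q)) ^ 2 = (4 * a.+2 * a.+2) * (p * q) ^ 2)%N by nia.
move: IH; set w := ((p * q) ^ 2)%N => IH; nia.
Qed.

(** * Two partitions into pairs *)

Section TwoByTwo.
Variables (T : finType) (a : nat).
Implicit Types f : T -> 'I_a.

Definition stabg f := [set s : {perm T} | [exists u : {perm 'I_a}, forall x, f (s x) == u (f x)]].

Lemma stabgP f s : reflect (stab f s) (s \in stabg f).
Proof.
rewrite inE; apply: (iffP existsP) => -[u su]; exists u; last by apply/forallP => x; apply/eqP.
by move=> x; apply/eqP/(forallP su).
Qed.

Lemma stabg_group_set f : group_set (stabg f).
Proof.
apply/group_setP; split; first by apply/stabgP; exists 1%g => x; rewrite !perm1.
by move=> s t /stabgP sf /stabgP tf; apply/stabgP/stabM.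
Qed.
Canonical stabg_group f := group (stabg_group_set f).

(** A permutation of the blocks and a choice of swap for each block determine a stabilising
    permutation, and distinct choices give distinct permutations. *)
Lemma card_stabg f : balanced 2 f -> (2 ^ a * a`! <= #|stabg f|)%N.
Proof.
move=> bf; have [p pP] : exists p : 'I_a -> T * T,
    forall j, [/\ (p j).1 != (p j).2, f (p j).1 = j & f (p j).2 = j].
  apply: (fin_all_exists (P := fun j q => [/\ q.1 != q.2, f q.1 = j & f q.2 = j])) => j.
  have /eqP/cards2P[x [y [xy fE]]] := bf j.
  exists (x, y); split=> //=; first have : x \in [set x | f x == j] by rewrite fE set21.
    by rewrite inE => /eqP.
  have : y \in [set x | f x == j] by rewrite fE set22.
  by rewrite inE => /eqP.
pose k (z : 'I_a * bool) := if z.2 then (p z.1).1 else (p z.1).2.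
have fk z : f (k z) = z.1 by rewrite /k; case: (pP z.1); case: ifP.
have k_inj : injective k.
  move=> [i c] [j d] kk; have /= ij : i = j by have := congr1 f kk; rewrite !fk.
  move: kk; rewrite /k ij /=; case: (pP j) => + _ _.
  by case: c; case: d => //= /eqP jj /esym; [move=> /esym|]; move/jj.
have [h kK hK] : bijective k.
  by apply: inj_card_bij k_inj _; rewrite card_prod card_bool card_ord (balanced_card bf).
have fE x : f x = (h x).1 by rewrite -{1}(hK x) fk.
pose m (w : {perm 'I_a} * {ffun 'I_a -> bool}) x := k (w.1 (h x).1, (h x).2 (+) w.2 (h x).1).
have m_inj w : injective (m w).
  move=> x y /k_inj [/perm_inj xy1]; rewrite xy1 => /addIb xy2.
  by apply: (can_inj hK); move: xy1 xy2; case: (h x) (h y) => [? ?] [? ?] /= -> ->.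
pose g w := perm (m_inj w).
have g_inj : injective g.
  move=> [u r] [v t] /permP gE.
  have mE j c : (u j, c (+) r j) = (v j, c (+) t j).
    by have := gE (k (j, c)); rewrite !permE /m kK /= => /k_inj.
  congr pair; first by apply/permP => j; have [] := mE j true.
  by apply/ffunP => j; have [] := mE j false.
have -> : (2 ^ a * a`! = #|{: {perm 'I_a} * {ffun 'I_a -> bool}}|)%N.
  by rewrite card_prod card_Sn card_ffun card_bool card_ord mulnC.
rewrite -cardsT -(card_imset _ g_inj); apply: subset_leq_card.
apply/subsetP => _ /imsetP[w _ ->]; apply/stabgP; exists w.1 => x.
by rewrite permE fk /= -fE.
Qed.

(* Otherwise the product set of the two stabilisers would have more than [(2a)!] elements. *)
Lemma not_rigid22 f1 f2 : (0 < a)%N -> balanced 2 f1 -> balanced 2 f2 -> ~ rigid [:: f1; f2].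
Proof.
move=> a_gt0 b1 b2 rig.
have cap1 : stabg f1 :&: stabg f2 = 1%g.
  apply/trivgP/subsetP => s; rewrite !inE -/(_ \in stabg _).
  by case/andP=> s1 s2; apply/eqP/rig; split; [|split=> //]; apply/stabgP; rewrite inE.
have := mul_cardG (stabg_group f1) (stabg_group f2).
rewrite /= cap1 cards1 muln1 => cE.
have : (#|(stabg f1 * stabg f2)%g| <= (a * 2)`!)%N.
  rewrite -(balanced_card b1) -cardsT -card_perm; apply: subset_leq_card.
  by apply/subsetP => s _; apply/subsetP => x _; rewrite inE.
rewrite -cE; have := fact_double_lt a_gt0.
have := card_stabg b1; have := card_stabg b2.
set x := #|_|; set y := #|_|; set z := (_ * _)%N => zx zy; rewrite -[(z ^ 2)%N]mulnn.
have := leq_mul zy zx; lia.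
Qed.

End TwoByTwo.

Lemma not_asym2 a (e : rel 'I_a) : (0 < a)%N -> regular 2 e -> ~ asym e.
Proof.
move=> a_gt0 reg /(edge_rigid (isT : 0 < 2)%N reg).
exact: not_rigid22 (efst_balanced reg) (esnd_balanced reg).
Qed.


(** * Three partitions into blocks of size at least three *)

Section ThreePartitions.
Variables (a b : nat).
Hypotheses (b_ge3 : (3 <= b)%N) (le_ba : (b <= a)%N).

Let a_gt0 : (0 < a)%N. Proof. lia. Qed.
Let a_gt1 : (1 < a)%N. Proof. lia. Qed.
Let b_gt0 : (0 < b)%N. Proof. lia. Qed.
Let b_gt1 : (1 < b)%N. Proof. lia. Qed.
Let b_gt2 : (2 < b)%N. Proof. lia. Qed.

Local Notation pt := ('I_a * 'I_b)%type.
Local Notation i0 := (Ordinal a_gt0).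
Local Notation i1 := (Ordinal a_gt1).
Local Notation k0 := (Ordinal b_gt0).
Local Notation k1 := (Ordinal b_gt1).
Local Notation k2 := (Ordinal b_gt2).

Definition rowl (x : pt) : 'I_a := x.1.
Definition coll (x : pt) : 'I_a := Ordinal (ltn_pmod (x.1 + x.2) a_gt0).
(* In row [i] the marked point lies in column [i], except that the one of row 0 lies in column 1. *)
Definition mark (i : 'I_a) : 'I_b := if i == i0 then k1 else k0.
Definition shiftl (x : pt) : 'I_a := if x.2 == mark x.1 then ordS x.1 else x.1.

Lemma card_fst_pair (B : 'I_a -> 'I_b -> bool) i :
  #|[set x : pt | (x.1 == i) && B x.1 x.2]| = #|[set k | B i k]|.
Proof.
have inj : injective (pair i : 'I_b -> pt) by move=> k l [].
rewrite -[RHS](card_imset _ inj); apply: eq_card => -[j k]; rewrite !inE /=.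
apply/andP/imsetP => [[/eqP -> Bk]|[l]]; first by exists k; rewrite ?inE.
by rewrite inE => Bl [-> ->].
Qed.

Lemma rowl_balanced : balanced b rowl.
Proof.
move=> i; transitivity #|[set k : 'I_b | true]|.
  by rewrite -(card_fst_pair (fun _ _ => true) i); apply: eq_card => x; rewrite !inE andbT.
by rewrite -[RHS]card_ord; apply: eq_card => k; rewrite !inE.
Qed.

Lemma coll_inj x y : rowl x = rowl y -> coll x = coll y -> x = y.
Proof.
case: x y => [i k] [j l]; rewrite /rowl /= => -> /(congr1 val) /= /eqP.
rewrite eqn_modDl !modn_small; try by apply: leq_trans (ltn_ord _) le_ba.
by move=> /eqP/val_inj ->.
Qed.

Lemma coll_balanced : balanced b coll.
Proof.
move=> j; have inj : {in [set x | coll x == j] &, injective snd}.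
  move=> [i k] [i' k']; rewrite !inE => /eqP xj /eqP yj /= kk.
  move: xj; rewrite -yj kk => /(congr1 val) /= /eqP; rewrite eqn_modDr !modn_small //.
  by move=> /eqP/val_inj ->.
rewrite -(card_in_imset inj) -[RHS]card_ord; apply: eq_card => k; rewrite [RHS]inE.
apply/imsetP; have lt : ((j + (a - k)) %% a < a)%N by apply: ltn_pmod.
exists (Ordinal lt, k) => //; rewrite inE; apply/eqP/val_inj; rewrite /= modnDml.
have := ltn_ord k; have := ltn_ord j => jlt klt.
by rewrite -addnA subnK ?modnDr ?modn_small //; lia.
Qed.

Lemma ordS_neq (i : 'I_a) : ordS i != i.
Proof.
rewrite -val_eqE /=; have := ltn_ord i => lti; case: (ltngtP i.+1 a) => h; last by rewrite h modnn; lia.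
  by rewrite modn_small //; lia.
by lia.
Qed.

(** Block [j] loses its own marked point and gains the one of row [j - 1]. *)
Lemma shiftl_balanced : balanced b shiftl.
Proof.
move=> j; pose p := ord_pred j.
have Sp i : (ordS i == j) = (i == p) by rewrite /p -[in RHS](inj_eq (@ordS_inj a)) ord_predK.
have pj : p != j by rewrite eq_sym -Sp ordS_neq.
transitivity #|[set x : pt | (x.1 == j) && (x.2 != mark x.1)]
               :|: [set x : pt | (x.1 == p) && (x.2 == mark x.1)]|.
  apply: eq_card => x; rewrite !inE /shiftl; case: ifP => // _; last by rewrite andbT andbF orbF.
  by rewrite andbF andbT Sp.
rewrite cardsU (_ : _ :&: _ = set0); last first.
  by apply/setP => x; rewrite !inE; case: (x.2 == _); rewrite ?andbF.
rewrite (card_fst_pair (fun i k => k != mark i)) (card_fst_pair (fun i k => k == mark i)).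
rewrite cards0 subn0 [[set k | k == _]](_ : _ = [set mark p]); last first.
  by apply/setP => k; rewrite !inE.
rewrite cards1 [[set k | _]](_ : _ = ~: [set mark j]); last by apply/setP => k; rewrite !inE.
by rewrite cardsC1 card_ord; lia.
Qed.

(** A row shares [b - 1 >= 2] points with the shifted block of the same index and at most one with
    any other, so [u = w] and marked points go to marked points. Hence [u] commutes with the cyclic
    successor, and the one column with two marked points pins it down. *)
Lemma rigid3 : rigid [:: rowl; coll; shiftl].
Proof.
move=> s [[u su] [[v sv] [[w sw] _]]].
have uw i : w i = u i.
  have two : exists k l : 'I_b, [/\ k != l, k != mark i & l != mark i].
    rewrite /mark; case: ifP => _; [exists k0, k2|exists k1, k2]; split=> //.
  case: two => k [l [kl ki li]].
  apply/eqP; apply/negPn/negP => wu.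
  have h m : m != mark i -> s (i, m) = (u i, mark (u i)).
    move=> mi; have := sw (i, m); have /= := su (i, m).
    rewrite /shiftl /rowl /= (negPf mi); case: (s (i, m)) => [i' m'] /= ->.
    by case: eqP => [-> //|_ uw]; rewrite uw eqxx in wu.
  have [kl'] : (i, k) = (i, l) by apply: (@perm_inj _ s); rewrite !h.
  by rewrite kl' eqxx in kl.
have smark i : s (i, mark i) = (u i, mark (u i)).
  have := sw (i, mark i); have /= := su (i, mark i).
  rewrite /shiftl /rowl /= eqxx uw; case: (s (i, mark i)) => [i' m'] /= ->.
  by case: eqP => [-> //|_ /perm_inj /esym/eqP]; rewrite (negPf (ordS_neq i)).
have uS i : u (ordS i) = ordS (u i).
  have := sw (i, mark i); rewrite smark uw /shiftl /= !eqxx => ->.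
  by [].
have cmark i : coll (i, mark i) = if i == i0 then i1 else i.
  apply: val_inj; rewrite /= /mark; case: (eqVneq i i0) => [-> /=|_].
    by rewrite add0n modn_small.
  by rewrite /= addn0 modn_small.
have S0 : ordS i0 = i1 by apply: val_inj; rewrite /= modn_small.
have i10 : i1 != i0 by [].
(* The marked points of rows 0 and 1 share column 1, so those of the consecutive rows [u 0] and
   [u 1] share a column too; this happens for no other row and its successor. *)
have u0 : u i0 = i0.
  have : coll (u i0, mark (u i0)) = coll (u i1, mark (u i1)).
    by rewrite -!smark !sv !cmark eqxx (negPf i10).
  have -> : u i1 = ordS (u i0) by rewrite -S0 uS.
  rewrite !cmark; case: (eqVneq (u i0) i0) => // _.
  case: (eqVneq (ordS (u i0)) i0) => [S_u0 u01|_ /esym/eqP].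
    by move/(congr1 val): S_u0; rewrite u01 /= modn_small //; lia.
  by rewrite (negPf (ordS_neq _)).
have u1 i : u i = i.
  case: i => n; elim: n => [|n IH] ltn; first by rewrite (_ : Ordinal ltn = i0) //; apply: val_inj.
  have -> : Ordinal ltn = ordS (Ordinal (ltnW ltn)) by apply: val_inj; rewrite /= modn_small.
  by rewrite uS IH.
(* Column [j != 0] contains the marked point of row [j], which is fixed; then column 0 is fixed as
   the remaining one. *)
have v1 j : j != i0 -> v j = j.
  move=> j0; have := sv (j, mark j); rewrite smark u1 cmark (negPf j0).
  by [].
have {}v1 j : v j = j.
  case: (eqVneq j i0) => [->|/v1 //]; apply/eqP/negPn/negP => /[dup] /v1 /perm_inj ->.
  by rewrite eqxx.
by apply/permP => x; rewrite perm1; apply: coll_inj; rewrite ?su ?u1 // sv v1.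
Qed.
End ThreePartitions.

Lemma ex_rigid_grid a b : (3 <= b <= a)%N ->
  exists fs : seq ('I_a * 'I_b -> 'I_a), [/\ size fs = 3, all_balanced b fs & rigid fs].
Proof.
case/andP=> b3 ba; exists [:: @rowl a b; coll b3 ba; shiftl b3 ba]; split=> //.
  by split; [apply: rowl_balanced|split; [apply: coll_balanced|split; [apply: shiftl_balanced|]]].
exact: rigid3.
Qed.


(** * Partitions into pairs *)

Lemma comp_std_balanced a b (h : 'I_(a * b) -> 'I_(a * b)) :
  injective h -> balanced b (fun x => std (h x)).
Proof.
move=> h_inj j; apply: etrans (lab_balanced (perm h_inj)^-1%g j).
by apply: eq_card => x; rewrite !inE /lab invgK permE.
Qed.

Section ThreeMatchings.
Variable a : nat.
Hypothesis a_ge4 : (4 <= a)%N.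
Local Notation pt := 'I_(a * 2).

(** The fibres of [rot_fun x %/ 2] are [{1,2}, {3,4}, ..., {2a-1,0}]; with the standard pairs they
    form a cycle of length [2a]. *)
Definition rot_fun (x : nat) := if x.+1 == (a * 2)%N then 0 else x.+1.
(* The fibres of [match_fun x %/ 2] are {0,1}, {2,5}, {3,2a-1}, {4,6}, {7,8}, {9,10}, ...; among
   them only {0,1} is also a fibre of [x %/ 2], and the reflection of the 2a-cycle that swaps 0
   and 1 maps {2,5} to {2a-1,2a-4}, which is not in the list. *)
Definition match_fun (x : nat) :=
  if (x <= 2)%N then x else if x == 3 then 4 else if x == 4 then 6 else if x == 5 then 3
  else if x == 6 then 7 else if x.+1 == (a * 2)%N then 5 else x.+1.

Lemma rot_fun_lt (x : pt) : (rot_fun x < a * 2)%N.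
Proof. by have := ltn_ord x; rewrite /rot_fun; case: ifP; lia. Qed.

Lemma match_fun_lt (x : pt) : (match_fun x < a * 2)%N.
Proof. by have := ltn_ord x; rewrite /match_fun; do ?[case: ifP => ?]; lia. Qed.

Definition rot x : pt := Ordinal (rot_fun_lt x).
Definition match3 x : pt := Ordinal (match_fun_lt x).

Lemma rot_inj : injective rot.
Proof.
move=> x y /(congr1 val) /= xy; apply: val_inj => /=; move: xy.
by have := ltn_ord x; have := ltn_ord y; rewrite /rot_fun; do ?[case: ifP => ?]; lia.
Qed.

Lemma match3_inj : injective match3.
Proof.
move=> x y /(congr1 val) /= xy; apply: val_inj => /=; move: xy.
by have := ltn_ord x; have := ltn_ord y; rewrite /match_fun; do ?[case: ifP => ?]; lia.
Qed.

Lemma rigid_matchings :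
  rigid [:: @std a 2; fun x => std (rot x); fun x => std (match3 x)].
Proof.
move=> s [[u su] [[v sv] [[w sw] _]]].
have pt_lt k : (k < 8)%N -> (k < a * 2)%N by lia.
have s_neq (x y : pt) : x != y :> nat -> s x != s y :> nat.
  by rewrite !val_eqE (inj_eq perm_inj).
have hu (x y : pt) : (x %/ 2 = y %/ 2)%N -> (s x %/ 2 = s y %/ 2)%N.
  move=> xy; have /(congr1 val) /= -> := su x; have /(congr1 val) /= -> := su y.
  by congr (val (u _)); apply: val_inj.
have hv (x y : pt) : (rot_fun x %/ 2 = rot_fun y %/ 2)%N -> (rot_fun (s x) %/ 2 = rot_fun (s y) %/ 2)%N.
  move=> xy; have /(congr1 val) /= -> := sv x; have /(congr1 val) /= -> := sv y.
  by congr (val (v _)); apply: val_inj.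
have hw (x y : pt) : (match_fun x %/ 2 = match_fun y %/ 2)%N ->
    (match_fun (s x) %/ 2 = match_fun (s y) %/ 2)%N.
  move=> xy; have /(congr1 val) /= -> := sw x; have /(congr1 val) /= -> := sw y.
  by congr (val (w _)); apply: val_inj.
pose p k (k8 : (k < 8)%N) : pt := Ordinal (pt_lt k k8).
(* [{0,1}] is the only pair common to the first and third matching, so [s] preserves it. *)
have [s0|s0] : s (p 0 isT) = 0%N :> nat /\ s (p 1 isT) = 1%N :> nat \/
               s (p 0 isT) = 1%N :> nat /\ s (p 1 isT) = 0%N :> nat.
- have := hu (p 0 isT) (p 1 isT) erefl; have := hw (p 0 isT) (p 1 isT) erefl.
  have := s_neq (p 0 isT) (p 1 isT) isT; have := ltn_ord (s (p 0 isT)); have := ltn_ord (s (p 1 isT)).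
  rewrite /match_fun; do ?[case: ifP => ?]; lia.
(* With 0 fixed, follow the cycle using the first two matchings alternately. *)
- suff H : forall n (lt : (n < a * 2)%N), s (Ordinal lt) = n :> nat.
    by apply/permP => -[n lt]; rewrite perm1; apply: val_inj; apply: H.
  elim=> [|n IH] lt; first by rewrite (_ : Ordinal lt = p 0 isT) ?(proj1 s0) //; apply: val_inj.
  have IH' := IH (ltnW lt); have := s_neq (Ordinal lt) (Ordinal (ltnW lt)).
  have := ltn_ord (s (Ordinal lt)).
  have := hu (Ordinal lt) (Ordinal (ltnW lt)); have := hv (Ordinal lt) (Ordinal (ltnW lt)).
  rewrite IH' /= /rot_fun; move: (nat_of_ord _) => k; do ?[case: ifP => ?]; lia.
(* Now [s] is the reflection [x -> 1 - x] of the cycle; its values up to 5 contradict the pair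
   [{2,5}]. *)
case: s0 => s0 s1; exfalso.
have s2 : s (p 2 isT) = (a * 2 - 1)%N :> nat.
  have := hv (p 1 isT) (p 2 isT); have := s_neq (p 1 isT) (p 2 isT) isT; rewrite s1 /= /rot_fun.
  have := ltn_ord (s (p 2 isT)); do ?[case: ifP => ?]; lia.
have s3 : s (p 3 isT) = (a * 2 - 2)%N :> nat.
  have := hu (p 2 isT) (p 3 isT) erefl; have := s_neq (p 2 isT) (p 3 isT) isT; rewrite /= s2.
  have := ltn_ord (s (p 3 isT)); lia.
have s4 : s (p 4 isT) = (a * 2 - 3)%N :> nat.
  have := hv (p 3 isT) (p 4 isT); have := s_neq (p 3 isT) (p 4 isT) isT; rewrite s3 /= /rot_fun.
  have := ltn_ord (s (p 4 isT)); do ?[case: ifP => ?]; lia.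
have s5 : s (p 5 isT) = (a * 2 - 4)%N :> nat.
  have := hu (p 4 isT) (p 5 isT) erefl; have := s_neq (p 4 isT) (p 5 isT) isT; rewrite /= s4.
  have := ltn_ord (s (p 5 isT)); lia.
have := hw (p 2 isT) (p 5 isT) erefl; rewrite s2 s5 /match_fun; do ?[case: ifP => ?]; lia.
Qed.

End ThreeMatchings.

Lemma ex_rigid_matchings a : (4 <= a)%N ->
  exists fs : seq ('I_(a * 2) -> 'I_a), [/\ size fs = 3, all_balanced 2 fs & rigid fs].
Proof.
move=> a4; exists [:: @std a 2; fun x => std (rot a4 x); fun x => std (match3 a4 x)]; split=> //.
  by split; [apply: std_balanced|split; [|split=> //]]; apply: comp_std_balanced;
    [apply: rot_inj | apply: match3_inj].
exact: rigid_matchings.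
Qed.


(** * Six points: three partitions into pairs fail, four suffice *)

Section Six.
Local Notation pt := 'I_6.
Implicit Types (s m : seq nat).

Definition perms6 := permutations (iota 0 6).

Definition matchings6 :=
  [seq m <- perms6 | all (fun i => (nth 0 m i != i) && (nth 0 m (nth 0 m i) == i)) (iota 0 6)].

Definition commutes6 s t :=
  all (fun i => nth 0 s (nth 0 t i) == nth 0 t (nth 0 s i)) (iota 0 6).

(* An outer automorphism of S_6 turns this into: any three transpositions of six letters commute
   with a common transposition. *)
Lemma matchings6_commute :
  all (fun m1 => all (fun m2 => all (fun m3 => has (fun m =>
    [&& commutes6 m m1, commutes6 m m2 & commutes6 m m3])
    matchings6) matchings6) matchings6) matchings6.
Proof. by vm_compute. Qed.

Definition code6 (h : pt -> pt) := [seq val (h (inord i)) | i <- iota 0 6].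

Lemma nth_code6 h (x : pt) : nth 0 (code6 h) x = h x.
Proof. by rewrite (nth_map 0) ?size_iota // nth_iota // add0n inord_val. Qed.

Lemma code6_perms h : injective h -> code6 h \in perms6.
Proof.
move=> h_inj; have U : uniq (code6 h).
  rewrite map_inj_in_uniq ?iota_uniq // => i j; rewrite !mem_iota /= => i6 j6.
  by move=> /val_inj /h_inj /(congr1 val); rewrite /= !inordK.
rewrite mem_permutations uniq_perm ?iota_uniq //.
apply: (uniq_min_size U _ _).2; last by rewrite size_map.
by move=> _ /mapP[i _ ->]; rewrite mem_iota /= ltn_ord.
Qed.

Lemma commutes6P s t : commutes6 s t ->
  forall x : pt, nth 0 s (nth 0 t x) = nth 0 t (nth 0 s x).
Proof. by move=> /allP st x; apply/eqP/st; rewrite mem_iota /=. Qed.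

Lemma mate_balanced (T : finType) k (f : T -> 'I_k) : balanced 2 f ->
  exists2 m : T -> T, (forall x, m x != x /\ m (m x) = x) &
    forall x y, f x = f y <-> y = x \/ y = m x.
Proof.
move=> bf; have [m mP] : exists m : T -> T, forall x, m x != x /\ [set y | f y == f x] = [set x; m x].
  apply: (fin_all_exists (P := fun x y => y != x /\ [set z | f z == f x] = [set x; y])) => x.
  have /eqP/cards2P[y [z [yz fE]]] := bf (f x).
  have := in_set2 x y z; rewrite -fE inE eqxx => /esym/orP[/eqP xE|/eqP xE]; rewrite xE in fE *.
    by exists z; rewrite eq_sym yz.
  by exists y; rewrite yz setUC.
have mE x y : f x = f y <-> y = x \/ y = m x.
  have [_ fE] := mP x; have := in_set2 y x (m x); rewrite -fE inE => H.
  split=> [xy|yx]; last by apply/eqP; rewrite eq_sym H; case: yx => ->; rewrite eqxx ?orbT.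
  by move: H; rewrite xy eqxx => /esym/orP[/eqP|/eqP]; [left|right].
exists m => // x; split; first by case: (mP x).
have fm : f (m x) = f x by apply/esym/mE; right.
have [mm|//] := (mE (m x) x).1 fm.
by case/negP: (mP x).1; rewrite -mm.
Qed.

(** A fixed-point-free involution commuting with those of the three matchings maps their pairs to
    pairs, so it lies in the common stabiliser. *)
Lemma not_rigid6 k (f1 f2 f3 : pt -> 'I_k) :
  balanced 2 f1 -> balanced 2 f2 -> balanced 2 f3 -> ~ rigid [:: f1; f2; f3].
Proof.
move=> b1 b2 b3 rig.
have [m1 m1P f1E] := mate_balanced b1; have [m2 m2P f2E] := mate_balanced b2.
have [m3 m3P f3E] := mate_balanced b3.
have code (m : pt -> pt) : (forall x : pt, m x != x /\ m (m x) = x) -> code6 m \in matchings6.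
  move=> mP; have m_inj : injective m by move=> x y xy; rewrite -(mP x).2 xy (mP y).2.
  rewrite mem_filter code6_perms // andbT; apply/allP => i; rewrite mem_iota /= => i6.
  by have := nth_code6 m (Ordinal i6); have [+ mm] := mP (Ordinal i6);
    rewrite -val_eqE /= => mi ->; rewrite mi nth_code6 mm /=.
have /allP/(_ _ (code _ m1P))/allP/(_ _ (code _ m2P))/allP/(_ _ (code _ m3P))/hasP[m] := matchings6_commute.
rewrite mem_filter => /andP[/allP mP m_perm] /and3P[/commutes6P c1 /commutes6P c2 /commutes6P c3].
have m_lt (x : pt) : (nth 0 m x < 6)%N.
  have xm : (x < size m)%N.
    by move: m_perm; rewrite mem_permutations => /perm_size ->; rewrite size_iota.
  by have := mem_nth 0 xm; move: m_perm; rewrite mem_permutations => /perm_mem ->; rewrite mem_iota.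
pose h x : pt := Ordinal (m_lt x).
have mP' (x : pt) : (h x != x) /\ h (h x) = x.
  by have /andP[mx /eqP mm] := mP x (ltac:(by rewrite mem_iota /=)); split=> //; apply: val_inj.
have h_inj : injective h by move=> x y xy; rewrite -(mP' x).2 xy (mP' y).2.
have hs k' (f : pt -> 'I_k') (m' : pt -> pt) : (forall x y, f x = f y <-> y = x \/ y = m' x) ->
    (forall x : pt, nth 0 m (nth 0 (code6 m') x) = nth 0 (code6 m') (nth 0 m x)) ->
    forall x y, f x = f y -> f (perm h_inj x) = f (perm h_inj y).
  move=> fE cm x y /fE xy; apply/fE; rewrite !permE; case: xy => ->; [by left|right].
  by apply: val_inj; have := cm x; rewrite nth_code6 /= => ->; apply: (nth_code6 m' (h x)).
have s1 : perm h_inj = 1%g.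
  apply: rig; split; [|split; [|split=> //]]; apply: stab_eq; try exact: (balanced_surj (isT : 0 < 2)%N).
  - by apply: (hs _ _ _ f1E) => x; apply: c1.
  - by apply: (hs _ _ _ f2E) => x; apply: c2.
  - by apply: (hs _ _ _ f3E) => x; apply: c3.
by have := (mP' ord0).1; have /permP/(_ ord0) := s1; rewrite permE perm1 => ->; rewrite eqxx.
Qed.

Definition label6 (l : seq nat) (x : pt) : 'I_3 := inord (nth 0 l x).

Definition labels6 : seq (seq nat) :=
  [:: [:: 0; 0; 1; 1; 2; 2]; [:: 0; 0; 1; 2; 1; 2]; [:: 0; 1; 0; 1; 2; 2]; [:: 0; 1; 0; 2; 1; 2]].

Definition fixes6 p := all (fun l => all (fun i => all (fun j =>
  (nth 0 l i == nth 0 l j) ==> (nth 0 l (nth 0 p i) == nth 0 l (nth 0 p j)))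
  (iota 0 6)) (iota 0 6)) labels6.

Lemma labels6_rigid : all (fun p => fixes6 p ==> (p == iota 0 6)) perms6.
Proof. by vm_compute. Qed.

Lemma card_set_ord n (p : pred nat) : #|[set x : 'I_n | p x]| = count p (iota 0 n).
Proof. by rewrite cardsE cardE size_filter -val_enum_ord count_map enumT. Qed.

Lemma nth_labels6_lt l i : l \in labels6 -> (i < 6)%N -> (nth 0 l i < 3)%N.
Proof.
have /allP ok : all (fun l => all (fun i => nth 0 l i < 3)%N (iota 0 6)) labels6 by [].
by move=> /ok/allP lt3 i6; apply: lt3; rewrite mem_iota.
Qed.

Lemma label6_balanced l : l \in labels6 -> balanced 2 (label6 l).
Proof.
move=> lL j.
transitivity #|[set x : pt | nth 0 l x == j]|.
  by apply: eq_card => x; rewrite !inE -val_eqE /= inordK ?nth_labels6_lt.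
rewrite (card_set_ord _ (fun i => nth 0 l i == j)).
have : all (fun l => all (fun k => count (fun i => nth 0 l i == k) (iota 0 6) == 2) (iota 0 3)) labels6 by [].
by move=> /allP/(_ _ lL)/allP/(_ j); rewrite mem_iota ltn_ord => /(_ isT)/eqP.
Qed.

Lemma rigid6 : rigid [seq label6 l | l <- labels6].
Proof.
move=> s sP; have code_s := code6_perms (@perm_inj _ s).
have sl l : l \in labels6 -> stab (label6 l) s.
  by move: sP; rewrite /= !inE => -[? [? [? [? _]]]] /or4P[] /eqP ->.
have fixs : fixes6 (code6 s).
  apply/allP => l lL; apply/allP => i; rewrite mem_iota => i6; apply/allP => j.
  rewrite mem_iota => j6; apply/implyP => /eqP ij; have [u su] := sl l lL.
  have xy : label6 l (Ordinal i6) = label6 l (Ordinal j6) by rewrite /label6 /= ij.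
  have := congr1 u xy; rewrite -!su /label6 => /(congr1 val).
  rewrite /= !inordK ?nth_labels6_lt // => sij.
  by rewrite (nth_code6 s (Ordinal i6)) (nth_code6 s (Ordinal j6)) sij.
have := allP labels6_rigid _ code_s; rewrite fixs => /eqP sE.
apply/permP => x; rewrite perm1; apply: val_inj => /=.
by rewrite -nth_code6 sE nth_iota.
Qed.

End Six.

Lemma ex_rigid_label6 :
  exists fs : seq ('I_6 -> 'I_3), [/\ size fs = 4, all_balanced 2 fs & rigid fs].
Proof.
exists [seq label6 l | l <- labels6]; split=> //; last exact: rigid6.
by do 4?[split; first exact: label6_balanced].
Qed.


(** * Cubic graphs with at most eight rows *)

Section BoolMatrices.
Implicit Types (r : seq bool) (rows : seq (seq bool)) (p : seq nat).

Fixpoint lex_ge r r' : bool :=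
  match r, r' with
  | x :: r1, y :: r1' => if x == y then lex_ge r1 r1' else x
  | _, _ => true
  end.

Fixpoint bools n : seq (seq bool) :=
  if n is n'.+1 then [seq x :: r | x <- [:: true; false], r <- bools n'] else [:: [::]].

Definition colseq rows j := [seq nth false r j | r <- rows].

(** Conditions met by the first rows of a lexicographically maximal asymmetric matrix. Equal rows
    would give a symmetry, whereas columns may still coincide in a prefix. *)
Definition canonical_prefix a d rows :=
  [&& sorted (fun r r' => lex_ge r r' && (r != r')) rows,
      all (fun j => count id (colseq rows j) <= d)%N (iota 0 a) &
      all (fun j => lex_ge (colseq rows j) (colseq rows j.+1)) (iota 0 a.-1)].

Fixpoint canonical_prefixes a d k : seq (seq (seq bool)) :=
  if k is k'.+1 then
    [seq rows <- [seq rcons rows r | rows <- canonical_prefixes a d k',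
                                     r <- [seq r <- bools a | count id r == d]]
       | canonical_prefix a d rows]
  else [:: [::]].

Definition inter a rows i i' :=
  count (fun j => nth false (nth [::] rows i) j && nth false (nth [::] rows i') j) (iota 0 a).

Definition extends_row_map a rows p x :=
  (x \notin p) && all (fun t => inter a rows x (nth 0 p t) == inter a rows (size p) t)
                      (iota 0 (size p)).

(* The row permutations that preserve the sizes of intersections of rows, as lists of images. *)
Fixpoint row_maps a rows k : seq (seq nat) :=
  if k is k'.+1 then
    flatten [seq [seq rcons p x | x <- iota 0 a & extends_row_map a rows p x]
            | p <- row_maps a rows k']
  else [:: [::]].

(** When the columns are distinct, a row permutation extends to an automorphism exactly when it maps
    the set of columns to itself. *)
Definition permutes_cols a rows p :=
  let cols := [seq colseq rows j | j <- iota 0 a] in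
  all (fun j => colseq [seq nth [::] rows (nth 0 p i) | i <- iota 0 a] j \in cols) (iota 0 a).

Definition has_symmetry a rows :=
  ~~ uniq [seq colseq rows j | j <- iota 0 a] ||
  has (fun p => (p != iota 0 a) && permutes_cols a rows p) (row_maps a rows a).

End BoolMatrices.


Lemma lex_ge_nth (r r' : seq bool) : size r = size r' ->
  (forall k, (k < size r)%N -> (forall l, (l < k)%N -> nth false r l = nth false r' l) ->
     nth false r' k -> nth false r k) -> lex_ge r r'.
Proof.
elim: r r' => [|x r IH] [|y r'] //= [szr] ge; case: eqP => [xy|xy].
  by apply: IH => // k kr eqr; apply: (ge k.+1) => // -[|l] //=; apply: eqr.
by have := ge 0 isT (fun l (l0 : (l < 0)%N) => False_ind _ (notF l0));
  case: x y xy {ge} => [] [] //= _ /(_ isT).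
Qed.

Lemma mem_bools r : r \in bools (size r).
Proof.
elim: r => //= x r IH; rewrite cats0 mem_cat; case: x; first by rewrite map_f.
by rewrite map_f ?orbT.
Qed.

Lemma mem_row_maps a rows k p : p \in row_maps a rows k ->
  [/\ size p = k, uniq p & all (fun x => x < a)%N p].
Proof.
elim: k p => [|k IH] p /=; first by rewrite inE => /eqP->.
case/flatten_mapP=> q /IH[szq uq qP] /mapP[x].
rewrite mem_filter mem_iota => /andP[/andP[xq _] /andP[_ xa]] ->.
by rewrite size_rcons szq rcons_uniq xq uq all_rcons qP andbT xa.
Qed.

(** The number with binary digits [f 0, ..., f (n-1)], most significant first; it turns
    lexicographic order into the order of numbers. *)
Fixpoint bin (f : nat -> bool) n := if n is n'.+1 then ((bin f n').*2 + f n')%N else 0.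

Lemma bin_lt f g n k : (k < n)%N -> (forall l, (l < k)%N -> f l = g l) ->
  ~~ f k -> g k -> (bin f n < bin g n)%N.
Proof.
move=> + fg fk gk; elim: n => // n IH; rewrite ltnS leq_eqVlt => /orP[/eqP kn|/IH] /=.
  subst k; rewrite (_ : bin f n = bin g n); first by rewrite (negPf fk) gk; lia.
  elim: n {IH fk gk} fg => //= n IH fg; rewrite fg // IH // => l ln; apply: fg; lia.
by case: (f n); case: (g n); lia.
Qed.

(** * Adjacency matrices and correctness of the search *)

Section Matrix.
Variable n : nat.
Local Notation a := n.+1.
Implicit Type e : rel 'I_a.

Definition flat e k := e (inord (k %/ a)) (inord (k %% a)).

(* A necessary condition for the row-major word of [e] to be lexicographically maximal among all
   matrices obtained from [e] by permuting rows and columns. *)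
Definition canonical e := forall (u v : {perm 'I_a}) (i j : 'I_a),
  (forall i' j' : 'I_a, (i' < i)%N || (i' == i) && (j' < j)%N -> e (u i') (v j') = e i' j') ->
  e (u i) (v j) -> e i j.

(** Choose row and column permutations for which the row-major word, read as a binary number, is
    largest; relabelling keeps degree and asymmetry. *)
Lemma ex_canonical d e : regular d e -> asym e ->
  exists e', [/\ regular d e', asym e' & canonical e'].
Proof.
move=> [re ce] ase; pose E (w : {perm 'I_a} * {perm 'I_a}) i j := e (w.1 i) (w.2 j).
have [[u v] _ max] := arg_maxnP (fun w => bin (flat (E w)) (a * a)) (isT : xpredT (1%g, 1%g)).
exists (E (u, v)); split.
- split=> [i|j].
    rewrite -(re (u i)) -(card_imset _ (@perm_inj _ v)); apply: eq_card => j; rewrite inE.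
    apply/imsetP/idP => [[k]|eij]; first by rewrite inE => + ->.
    by exists (v^-1%g j); rewrite ?inE /E /= permKV.
  rewrite -(ce (v j)) -(card_imset _ (@perm_inj _ u)); apply: eq_card => i; rewrite inE.
  apply/imsetP/idP => [[k]|eij]; first by rewrite inE => + ->.
  by exists (u^-1%g i); rewrite ?inE /E /= permKV.
- move=> u' v' uv; have [|/permP u1 /permP v1] := ase (u^-1 * u' * u)%g (v^-1 * v' * v)%g.
    by move=> i j; rewrite !permM; have := uv (u^-1%g i) (v^-1%g j); rewrite /E /= !permKV.
  split; apply/permP => i; rewrite perm1.
    by have := u1 (u i); rewrite !permM permK perm1 => /perm_inj.
  by have := v1 (v i); rewrite !permM permK perm1 => /perm_inj.
move=> u' v' i j eqE uvij; apply: contraT => eij.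
have /= := max (u' * u, v' * v)%g isT; rewrite leqNgt => /negP[].
have lt_k : (i * a + j < a * a)%N by have := ltn_ord i; have := ltn_ord j; nia.
have divk : ((i * a + j) %/ a = i)%N by rewrite divnMDl // divn_small ?addn0.
have modk : ((i * a + j) %% a = j)%N by rewrite modnMDl modn_small.
apply: (bin_lt lt_k); rewrite /flat ?divk ?modk ?inord_val //; last first.
  by rewrite /E /= !permM.
move=> l lk; have ld : (l %/ a < a)%N by rewrite ltn_divLR //; lia.
rewrite /E /= !permM; symmetry; apply: eqE.
rewrite -val_eqE /= !inordK ?ltn_pmod //; have := divn_eq l a; have := ltn_pmod l (ltn0Sn n).
have := ltn_ord j; move: (l %/ a) (l %% a) => q r; nia.
Qed.

Definition entry e (i j : nat) := e (inord i) (inord j).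
Definition top_rows e k := mkseq (fun i => mkseq (entry e i) a) k.

Lemma asym_rows e i i' : asym e -> (forall j, e i j = e i' j) -> i = i'.
Proof.
move=> ase ii'; have [|+ _] := ase (tperm i i') 1%g.
  by move=> k j; rewrite perm1; case: tpermP => // ->; rewrite ii'.
by move=> /permP/(_ i); rewrite tpermL perm1.
Qed.

Lemma asym_cols e j j' : asym e -> (forall i, e i j = e i j') -> j = j'.
Proof.
move=> ase jj'; have [|_] := ase 1%g (tperm j j').
  by move=> i k; rewrite perm1; case: tpermP => // ->; rewrite jj'.
by move=> /permP/(_ j); rewrite tpermL perm1.
Qed.

Lemma nth_top_rows e k i : (i < k)%N -> nth [::] (top_rows e k) i = mkseq (entry e i) a.
Proof. by move=> ik; rewrite nth_mkseq. Qed.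

Lemma colseq_top_rows e k j : (j < a)%N -> colseq (top_rows e k) j = mkseq (entry e ^~ j) k.
Proof. by move=> ja; rewrite /colseq /top_rows -map_comp; apply: eq_map => i /=; rewrite nth_mkseq. Qed.

Lemma count_entry_row e (i : 'I_a) : count id (mkseq (entry e i) a) = #|[set j | e i j]|.
Proof.
rewrite count_map -card_set_ord; apply: eq_card => j; rewrite !inE /= /entry.
by rewrite !inord_val.
Qed.

Lemma count_entry_col e (j : 'I_a) : count id (mkseq (entry e ^~ j) a) = #|[set i | e i j]|.
Proof.
rewrite count_map -card_set_ord; apply: eq_card => i; rewrite !inE /= /entry.
by rewrite !inord_val.
Qed.

(** Maximality tested on transpositions of adjacent rows and of adjacent columns gives the two
    orderings; asymmetry excludes equal rows. *)
Lemma top_rows_canonical e d k : regular d e -> asym e -> canonical e ->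
  (k <= a)%N -> top_rows e k \in canonical_prefixes a d k.
Proof.
move=> [re ce] ase can; elim: k => // k IH ka; rewrite /canonical_prefixes -/canonical_prefixes.
rewrite mem_filter; apply/andP; split; last first.
  apply/allpairsP; exists (top_rows e k, mkseq (entry e k) a).
  split; [exact: IH (ltnW ka)| |by rewrite /top_rows mkseqS].
  rewrite [(_, _).2]/= mem_filter (count_entry_row e (Ordinal ka)) re eqxx /=.
  by have := mem_bools (mkseq (entry e k) a); rewrite size_mkseq.
apply/and3P; split.
- apply/(sortedP [::]) => i; rewrite size_mkseq => ik; rewrite !nth_top_rows //; last lia.
  have ia : (i < a)%N by lia. have i1a : (i.+1 < a)%N by lia.
  pose x := Ordinal ia; pose y := Ordinal i1a.
  have iE : inord i = x by apply: val_inj; rewrite /= inordK.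
  have i1E : inord i.+1 = y by apply: val_inj; rewrite /= inordK.
  apply/andP; split.
    apply: lex_ge_nth => [|j]; first by rewrite !size_mkseq.
    rewrite size_mkseq => ja eqj; rewrite !nth_mkseq //.
    pose z := Ordinal ja; have jE : inord j = z by apply: val_inj; rewrite /= inordK.
    rewrite /entry iE i1E jE => eyz; apply: (can (tperm x y) 1%g); last by rewrite tpermL perm1.
    move=> i' j' lt; rewrite perm1; case: tpermP lt => [->|->|//].
      rewrite ltnn eqxx /= => lt; have := eqj j' lt; rewrite !nth_mkseq ?ltn_ord //.
      by rewrite /entry iE i1E inord_val => ->.
    by rewrite -val_eqE /=; lia.
  apply/eqP => rowE; have xy : x = y.
    apply: (asym_rows ase) => j; have := congr1 (fun r => nth false r j) rowE.
    by rewrite !nth_mkseq ?ltn_ord // /entry inord_val iE i1E.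
  by move/(congr1 val): xy => /=; lia.
- apply/allP => j; rewrite mem_iota => /andP[_ ja]; rewrite colseq_top_rows //.
  rewrite -(ce (Ordinal ja)) -count_entry_col.
  have -> : mkseq (entry e ^~ j) k.+1 = take k.+1 (mkseq (entry e ^~ j) a).
    by rewrite /mkseq -map_take take_iota (minn_idPl ka).
  by apply: leq_count_subseq; apply: take_subseq.
- apply/allP => j; rewrite mem_iota => /andP[_ j1a].
  have ja : (j < a)%N by lia. have {}j1a : (j.+1 < a)%N by lia.
  rewrite !colseq_top_rows //; apply: lex_ge_nth => [|i]; first by rewrite !size_mkseq.
  rewrite size_mkseq => ik eqi; rewrite !nth_mkseq //.
  have ia : (i < a)%N by lia.
  pose x := Ordinal ja; pose y := Ordinal j1a; pose z := Ordinal ia.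
  have jE : inord j = x by apply: val_inj; rewrite /= inordK.
  have j1E : inord j.+1 = y by apply: val_inj; rewrite /= inordK.
  have iE : inord i = z by apply: val_inj; rewrite /= inordK.
  rewrite /entry iE jE j1E => ezy; apply: (can 1%g (tperm x y)); last by rewrite tpermL perm1.
  move=> i' j' lt; rewrite perm1; case: (ltnP i' i) lt => [i'i _|_ /andP[/eqP-> lt]].
    have := eqi i' i'i; rewrite !nth_mkseq ?(ltn_trans i'i) // /entry inord_val jE j1E => eqxy.
    by case: tpermP => // ->.
  by case: tpermP lt => // -> /=; lia.
Qed.

(** A row permutation [u] that permutes the columns comes with [v] such that
    [e (u i) j = e i (v j)]; since columns are distinct, [v] is injective, and [u] with [v^-1] is a
    nontrivial automorphism. *)
Lemma has_symmetryP e : has_symmetry a (top_rows e a) -> ~ asym e.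
Proof.
move=> + ase; case/orP.
  case/negP; rewrite map_inj_in_uniq ?iota_uniq // => j j'.
  rewrite !mem_iota => /andP[_ ja] /andP[_ j'a].
  rewrite !colseq_top_rows // => jj'.
  suff [] : Ordinal ja = Ordinal j'a by [].
  have jE k (ka : (k < a)%N) : inord k = Ordinal ka by apply: val_inj; rewrite /= inordK.
  apply: (asym_cols ase) => i; have := congr1 (fun r => nth false r i) jj'.
  by rewrite !nth_mkseq ?ltn_ord // /entry inord_val !jE.
case/hasP=> p p_map /andP[p_neq /allP perm_p].
have [szp up pP] := mem_row_maps p_map.
have u_lt (i : 'I_a) : (nth 0 p i < a)%N by apply: (allP pP); rewrite mem_nth ?szp.
pose u i := Ordinal (u_lt i).
have u_inj : injective u.
  by move=> i j /(congr1 val) /eqP /=; rewrite nth_uniq ?szp // => /eqP/val_inj.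
have [v vP] : exists v : 'I_a -> 'I_a, forall j, forall i, e (u i) j = e i (v j).
  apply: (fin_all_exists (P := fun j k => forall i, e (u i) j = e i k)) => j.
  have := perm_p j; rewrite mem_iota ltn_ord => /(_ isT)/mapP[k]; rewrite mem_iota => /andP[_ ka] cE.
  exists (Ordinal ka) => i; move: cE; rewrite colseq_top_rows // => /(congr1 (fun r => nth false r i)).
  rewrite nth_mkseq // /entry inord_val (_ : inord k = Ordinal ka); last first.
    by apply: val_inj; rewrite /= inordK.
  move<-; rewrite /colseq -map_comp (nth_map 0) ?size_iota // nth_iota // add0n /=.
  rewrite nth_top_rows ?u_lt // nth_mkseq // /entry inord_val; congr (e _ _).
  by apply: val_inj; rewrite /= inordK.
have v_inj : injective v.
  move=> j j' jj'; apply: (asym_cols ase) => i; rewrite -(f_invF u_inj i).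
  by rewrite !vP jj'.
have [|/permP u1 _] := ase (perm u_inj) (perm v_inj)^-1%g.
  by move=> i j; rewrite permE vP -[X in e _ X = _](permE v_inj) permKV.
case/negP: p_neq; apply/eqP/(@eq_from_nth _ 0); rewrite ?size_iota // => i; rewrite szp => ia.
by have := u1 (Ordinal ia); rewrite permE perm1 nth_iota // => /(congr1 val).
Qed.

(** The row part of an automorphism preserves intersection sizes and permutes the columns, so it
    occurs in [row_maps] and must be the identity; distinct columns then leave no freedom for
    [v]. *)
Lemma asym_check e : uniq [seq colseq (top_rows e a) j | j <- iota 0 a] ->
  all (fun p => permutes_cols a (top_rows e a) p ==> (p == iota 0 a)) (row_maps a (top_rows e a) a) ->
  asym e.
Proof.
move=> ucols maps u v uv.
have interE (i i' : nat) : (i < a)%N -> (i' < a)%N ->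
    inter a (top_rows e a) (u (inord i)) (u (inord i')) = inter a (top_rows e a) i i'.
  move=> ia i'a.
  have interE' (k k' : 'I_a) : inter a (top_rows e a) k k' = #|[set j | e k j && e k' j]|.
    rewrite /inter -card_set_ord; apply: eq_card => j; rewrite !inE !nth_top_rows //.
    by rewrite !nth_mkseq // /entry !inord_val.
  rewrite -[in RHS](inordK ia) -[in RHS](inordK i'a) !interE'.
  rewrite -[RHS](card_imset _ (@perm_inj _ v)); apply: eq_card => j; rewrite inE.
  apply/idP/imsetP => [eij|[l]]; last first.
    by rewrite inE => + ->; rewrite (uv (inord i) l) (uv (inord i') l).
  exists (v^-1%g j); rewrite ?permKV // inE.
  by rewrite -(uv (inord i)) -(uv (inord i')) permKV.
have mem_map k : (k <= a)%N -> mkseq (fun i => val (u (inord i))) k \in row_maps a (top_rows e a) k.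
  elim: k => // k IH ka; apply/flatten_mapP; exists (mkseq (fun i => val (u (inord i))) k).
    exact: IH (ltnW ka).
  rewrite mkseqS; apply: map_f; rewrite mem_filter mem_iota ltn_ord /extends_row_map size_mkseq !andbT.
  apply/andP; split.
    apply/negP => /mapP[i]; rewrite mem_iota => /andP[_ ik] /val_inj/perm_inj/(congr1 val) /=.
    rewrite !inordK //; lia.
  apply/allP => t; rewrite mem_iota => /andP[_ tk]; rewrite nth_mkseq // interE //; lia.
have /(_ (leqnn a)) p_map := mem_map a.
have := allP maps _ p_map; rewrite (_ : permutes_cols _ _ _ = true); last first.
  apply/allP => j; rewrite mem_iota => /andP[_ ja].
  apply/mapP; exists (val (v^-1%g (inord j))); first by rewrite mem_iota ltn_ord.
  rewrite colseq_top_rows ?ltn_ord // /colseq -map_comp; apply/eq_in_map => i.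
  rewrite mem_iota => /andP[_ ia] /=; rewrite nth_mkseq // nth_top_rows // nth_mkseq //.
  by rewrite /entry !inord_val -(uv (inord i)) permKV.
move=> /eqP u_id.
have u1 i : u i = i.
  apply: val_inj; have := congr1 (fun p => nth 0 p i) u_id.
  by rewrite nth_mkseq ?ltn_ord // nth_iota ?ltn_ord // inord_val.
split; apply/permP => i; rewrite perm1 //.
have jE k (ka : (k < a)%N) : inord k = Ordinal ka by apply: val_inj; rewrite /= inordK.
have : colseq (top_rows e a) (v i) = colseq (top_rows e a) i.
  rewrite !colseq_top_rows ?ltn_ord //; apply/eq_mkseq => k.
  by rewrite /entry !inord_val -{1}(u1 (inord k)) (uv (inord k)).
have szc : size [seq colseq (top_rows e a) j | j <- iota 0 a] = a by rewrite size_map size_iota.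
have := nth_uniq [::] (i := v i) (j := i) _ _ ucols; rewrite szc !ltn_ord => /(_ isT isT).
rewrite !(nth_map 0) ?size_iota ?ltn_ord // !nth_iota ?ltn_ord // !add0n => + vi.
by rewrite vi eqxx => /esym/eqP/val_inj.
Qed.

End Matrix.

Lemma not_asym_of_symmetries a d : all (has_symmetry a.+1) (canonical_prefixes a.+1 d a.+1) ->
  forall e : rel 'I_a.+1, regular d e -> ~ asym e.
Proof.
move=> /allP sym e reg ase; have [e' [reg' ase' can']] := ex_canonical reg ase.
have := sym _ (top_rows_canonical reg' ase' can' (leqnn _)).
by move/has_symmetryP.
Qed.

Lemma not_asym3 a (e : rel 'I_a) : a = 6 \/ a = 7 -> regular 3 e -> ~ asym e.
Proof.
by case=> a_eq; subst a; move: e; apply: not_asym_of_symmetries; vm_compute.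
Qed.

(** The circulant [i ~ i, i+1, i+2] modulo 8 with the edges (0,0), (2,3) replaced by (0,3), (2,0),
    and (0,1), (3,5) by (0,5), (3,1). *)
Definition rows8 : seq (seq nat) :=
  [:: [:: 2; 3; 5]; [:: 1; 2; 3]; [:: 0; 2; 4]; [:: 1; 3; 4];
      [:: 4; 5; 6]; [:: 5; 6; 7]; [:: 0; 6; 7]; [:: 0; 1; 7]].

Lemma ex_asym8 : exists2 e : rel 'I_8, regular 3 e & asym e.
Proof.
pose mx i j := j \in nth [::] rows8 i; pose e : rel 'I_8 := fun i j => mx i j.
have rowsE : top_rows e 8 = mkseq (fun i => mkseq (mx i) 8) 8.
  apply/eq_in_map => i; rewrite mem_iota => /andP[_ i8]; apply/eq_in_map => j.
  by rewrite mem_iota => /andP[_ j8]; rewrite /entry /e !inordK.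
have ok (i : 'I_8) : count (mx i) (iota 0 8) = 3 /\ count (mx^~ i) (iota 0 8) = 3.
  have /allP/(_ i) : all (fun i => (count (mx i) (iota 0 8) == 3) &&
                                   (count (mx^~ i) (iota 0 8) == 3)) (iota 0 8) by [].
  by rewrite mem_iota ltn_ord => /(_ isT) /andP[/eqP -> /eqP ->].
exists e; last by apply: asym_check; rewrite rowsE; vm_compute.
split=> i; first by rewrite (card_set_ord _ (mx i)) (ok i).1.
by rewrite (card_set_ord _ (mx^~ i)) (ok i).2.
Qed.


(** * Asymmetric switched circulant graphs *)

Section Switch.
Variable a : nat.
Implicit Types e : rel 'I_a.

Definition switch e i i' j j' : rel 'I_a := fun x y =>
  ~~ ((x == i) && (y == j) || (x == i') && (y == j')) &&
  [|| (x == i) && (y == j'), (x == i') && (y == j) | e x y].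

Lemma card_switch_row e i i' j j' x : e i j -> e i' j' -> ~~ e i j' -> ~~ e i' j ->
  #|[set y | switch e i i' j j' x y]| = #|[set y | e x y]|.
Proof.
move=> eij eij' neij neij'.
have ii' : i' != i by apply: contraNneq neij' => ->.
have jj' : j' != j by apply: contraNneq neij => ->.
have row k l (A : {set 'I_a}) : k \in A -> l \notin A -> #|l |: (A :\ k)| = #|A|.
  by move=> kA lA; rewrite cardsU1 (cardsD1 k A) kA !inE (negPf lA) andbF.
have [->|xi] := eqVneq x i; [|have [->|xi'] := eqVneq x i'].
- rewrite -(row j j' [set y | e i y]) ?inE //; apply: eq_card => y.
  rewrite !inE /switch eqxx (eq_sym i) (negPf ii') /= orbF.
  by have [->|] := eqVneq y j'; rewrite ?jj' //= andbC.
- rewrite -(row j' j [set y | e i' y]) ?inE //; apply: eq_card => y.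
  rewrite !inE /switch eqxx (negPf ii') /=.
  by have [->|] := eqVneq y j; rewrite ?(eq_sym j) ?jj' //= andbC.
by apply: eq_card => y; rewrite !inE /switch (negPf xi) (negPf xi').
Qed.

Lemma regular_switch d e i i' j j' : e i j -> e i' j' -> ~~ e i j' -> ~~ e i' j ->
  regular d e -> regular d (switch e i i' j j').
Proof.
move=> eij eij' neij neij' [re ce]; split=> x; first by rewrite card_switch_row.
(* Columns are the rows of the transposed relation, which is switched at the transposed places. *)
rewrite -(ce x) -(@card_switch_row (fun y x => e x y) j j' i i' x) //.
by apply: eq_card => y; rewrite !inE /switch !(andbC (x == _)) orbCA.
Qed.

End Switch.

Section Circulant.
Variables (a d : nat).
Hypothesis le_da : (d <= a)%N.

(** Cyclic intervals of length [d]; the second disjunct is the wrap-around, written without division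
    to suit linear arithmetic. *)
Definition circ (r c : nat) := (r <= c < r + d)%N || (c + a < r + d)%N.

Lemma circ_regular : regular d (fun i j : 'I_a => circ i j).
Proof.
have row_lt (i : 'I_a) (o : 'I_d) : ((if i + o < a then i + o else i + o - a) < a)%N.
  by have := ltn_ord i; have := ltn_ord o; case: ifP; lia.
have col_lt (j : 'I_a) (o : 'I_d) : ((if o <= j then j - o else j + a - o) < a)%N.
  by have := ltn_ord j; have := ltn_ord o; case: ifP; lia.
split=> i.
  have inj : injective (fun o => Ordinal (row_lt i o)).
    move=> o o' /(congr1 val) /= oo; apply: val_inj; move: oo => /=.
    by have := ltn_ord o; have := ltn_ord o'; do ?[case: ifP => ?]; lia.
  rewrite -[RHS]card_ord -(card_imset _ inj); apply: eq_card => j; rewrite inE.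
  apply/idP/imsetP => [ij|[o _ ->]]; last first.
    by have := ltn_ord i; have := ltn_ord o; rewrite /circ /=; case: ifP => ?; lia.
  have lto : ((if i <= j then j - i else j + a - i) < d)%N.
    by move: ij; have := ltn_ord i; have := ltn_ord j; rewrite /circ; case: ifP => ?; lia.
  exists (Ordinal lto) => //; apply: val_inj => /=.
  by have := ltn_ord i; have := ltn_ord j; case: (leqP i j) => ?; case: ifP => ?; lia.
have inj : injective (fun o => Ordinal (col_lt i o)).
  move=> o o' /(congr1 val) /= oo; apply: val_inj; move: oo => /=.
  by have := ltn_ord i; have := ltn_ord o; have := ltn_ord o'; do ?[case: ifP => ?]; lia.
rewrite -[RHS]card_ord -(card_imset _ inj); apply: eq_card => j; rewrite inE.
apply/idP/imsetP => [ij|[o _ ->]]; last first.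
  by have := ltn_ord i; have := ltn_ord o; rewrite /circ /=; case: ifP => ?; lia.
have lto : ((if j <= i then i - j else i + a - j) < d)%N.
  by move: ij; have := ltn_ord i; have := ltn_ord j; rewrite /circ; case: ifP => ?; lia.
exists (Ordinal lto) => //; apply: val_inj => /=.
by have := ltn_ord i; have := ltn_ord j; case: (leqP j i) => ?; case: ifP => ?; lia.
Qed.

End Circulant.

(** * Rows with nearly equal neighbourhoods *)

Section Near.
Variable a : nat.
Implicit Types (e : rel 'I_a) (i j : 'I_a) (u v : {perm 'I_a}).

(** The neighbourhood of [i] exceeds that of [i'] by at most [m] vertices. This is invariant under
    automorphisms; [near 1] serves as a reflexive graph on the rows. *)
Definition near e m i i' :=
  exists2 l : seq 'I_a, size l = m & forall c, e i c -> e i' c \/ c \in l.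

Lemma aut_inv e u v : aut e u v -> aut e u^-1 v^-1.
Proof. by move=> uv i j; rewrite -uv !permKV. Qed.

Lemma near_aut e u v m i i' : aut e u v -> near e m i i' -> near e m (u i) (u i').
Proof.
move=> uv [l szl near_l]; exists (map v l); first by rewrite size_map.
move=> c; rewrite -{1}(permKV v c) uv => /near_l [eic|cl].
  by left; rewrite -(permKV v c) uv.
by right; rewrite -(permKV v c) map_f.
Qed.

Lemma near_autE e u v m i i' : aut e u v -> near e m (u i) i' <-> near e m i (u^-1%g i').
Proof.
move=> uv; split=> [/(near_aut (aut_inv uv))|/(near_aut uv)]; first by rewrite permK.
by rewrite permKV.
Qed.

(** An automorphism permutes the rows along with the relation [near m], so it fixes the only
    isolated row. *)
Lemma aut_isolated e u v m i : aut e u v -> (forall s, near e m i s -> s = i) ->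
  (forall r, r != i -> exists2 s, s != r & near e m r s) -> u i = i.
Proof.
move=> uv isol nonisol; apply/eqP; apply: contraT => /nonisol[s su].
by move=> /(near_autE _ _ _ uv)/isol si; rewrite -(permKV u s) si eqxx in su.
Qed.

(** An end of a path has at most one neighbour besides itself, hence so has its image. *)
Lemma aut_end e u v m i j (s s' : 'I_a) : aut e u v ->
  (forall t, near e m i t -> t = i \/ t = j) ->
  uniq [:: u i; s; s'] -> near e m (u i) s -> ~ near e m (u i) s'.
Proof.
move=> uv end_i; rewrite /= !inE negb_or => /andP[/andP[us us'] /andP[ss' _]].
have near_u t : near e m (u i) t -> u i != t -> t = u j.
  move=> /(near_autE _ _ _ uv)/end_i [] t_u; rewrite -[t](permKV u) t_u //.
  by rewrite eqxx.
by move=> /near_u/(_ us) sE /near_u/(_ us') s'E; rewrite sE s'E eqxx in ss'.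
Qed.

Lemma perm_fix_val u (i j : 'I_a) : u j = j -> u i = j :> nat -> i = j :> nat.
Proof. by move=> uj uij; congr val; apply: (@perm_inj _ u); rewrite uj; apply: val_inj. Qed.

Lemma perm_fix_le u i : (forall j, (j < i)%N -> u j = j) -> (u i <= i)%N -> u i = i.
Proof.
move=> fix_lt; rewrite leq_eqVlt => /orP[/eqP/val_inj //|lt_ui].
by apply: (@perm_inj _ u); rewrite fix_lt.
Qed.

Lemma aut_cols e u v : aut e u v -> u = 1%g ->
  (forall c c' : 'I_a, (c < c')%N -> exists r, e r c != e r c') -> v = 1%g.
Proof.
move=> uv u1 dcols; apply/permP => c; rewrite perm1.
have eqc r : e r (v c) = e r c by rewrite -[in RHS]uv u1 perm1.
by apply/eqP; rewrite -val_eqE /=; case: ltngtP => // /dcols[r]; rewrite eqc eqxx.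
Qed.

End Near.

(** * The circulant graph with one switch *)

Section Family.
Variables (a d k q : nat).

(* The circulant graph with the edges (0,0), (k,q) replaced by (0,q), (k,0). *)
Definition fam (r c : nat) :=
  ~~ ((r == 0) && (c == 0) || (r == k) && (c == q)) &&
  [|| (r == 0) && (c == q), (r == k) && (c == 0) | circ a d r c].

Local Notation famo := (fun i j : 'I_a => fam i j).

Lemma fam_regular : (0 < d <= a)%N -> (0 < k <= q)%N -> (d <= q < k + d)%N -> (q < a)%N ->
  (k + d <= a)%N -> regular d famo.
Proof.
case/andP=> d_gt0 da /andP[k_gt0 kq] /andP[dq qkd] qa kda.
have lt0 : (0 < a)%N by lia. have ltk : (k < a)%N by lia.
apply: (@regular_switch a d _ (Ordinal lt0) (Ordinal ltk) (Ordinal lt0) (Ordinal qa) _ _ _ _ (circ_regular da));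
  by rewrite /circ /=; lia.
Qed.

Definition far_witness r s c := [&& (c < a)%N, fam r c & ~~ fam s c].

Lemma fam_far m (ws : seq nat) (i i' : 'I_a) : uniq ws -> (m < size ws)%N ->
  all (far_witness i i') ws -> ~ near famo m i i'.
Proof.
move=> uws szws /allP wsP [l szl near_l].
suff : (size ws <= size (map val l))%N by rewrite size_map szl leqNgt szws.
apply: uniq_leq_size uws _ => c /wsP /and3P[ca ic /negP ni'c].
by case: (near_l (Ordinal ca) ic) => // /(map_f val).
Qed.

Lemma fam_near1 x (i i' : 'I_a) : (x < a)%N ->
  (forall c, (c < a)%N -> fam i c -> fam i' c \/ c = x) -> near famo 1 i i'.
Proof.
move=> xa near_x; exists [:: Ordinal xa] => // c /(near_x _ (ltn_ord c))[|cx]; first by left.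
by right; rewrite inE -val_eqE /= cx.
Qed.

Lemma fam_near2 x y (i i' : 'I_a) : (x < a)%N -> (y < a)%N ->
  (forall c, (c < a)%N -> fam i c -> [|| fam i' c, c == x | c == y]) -> near famo 2 i i'.
Proof.
move=> xa ya near_x; exists [:: Ordinal xa; Ordinal ya] => // c /(near_x _ (ltn_ord c))/or3P.
by case=> cx; [left|right|right]; rewrite ?inE -?val_eqE /= ?cx ?orbT.
Qed.

End Family.

Ltac fam_lia := rewrite ?/far_witness ?/fam ?/circ /=; lia.
(** [far] refutes nearness by listing columns of the first row missing in the second; [near1] and
    [near2] prove it by naming the exceptional columns. *)
Ltac far ws := apply: (@fam_far _ _ _ _ _ ws); [rewrite /= ?inE; lia|by []|
  rewrite /= ?andbT; do ?[apply/andP; split]; fam_lia].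
Ltac near1 x := apply: (@fam_near1 _ _ _ _ x); [lia|move=> c ca; fam_lia].
Ltac near2 x y := apply: (@fam_near2 _ _ _ _ x y); [lia|lia|move=> c ca; fam_lia].

Section FamilyFar.
Variables (a d k q : nat).
Hypotheses (d_ge2 : (2 <= d)%N) (le_da : (2 * d <= a)%N) (ltda : (d.+2 <= a)%N).
Local Notation famo := (fun i j : 'I_a => fam a d k q i j).

(** As row 0 is excluded, distance at least two on the line is distance at least two on the cycle.
    The witnesses are the first two columns of [r] or the two that follow the interval of [s],
    modulo [a]. *)
Lemma circ_far (r s : 'I_a) : (r != 0 :> nat) -> (r != k :> nat) ->
  (s != 0 :> nat) -> (s != k :> nat) ->
  (s.+1 < r)%N || (r.+1 < s)%N -> ~ near famo 1 r s.
Proof.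
move=> r0 rk s0 sk rs; have := ltn_ord r; have := ltn_ord s => sa ra.
case: (ltnP r s) => lt_rs.
  case: (leqP (s + d) (a + r)) => sdar; first by far [:: r : nat; r.+1].
  by far [:: (s + d - a)%N; (s + d - a).+1].
case: (leqP (s + d) r) => sdr.
  case: (ltnP r.+1 a) => r1a; first by far [:: r : nat; r.+1].
  by far [:: r : nat; 0].
case: (ltnP (s + d).+1 a) => sda; first by far [:: (s + d)%N; (s + d).+1].
case: (ltnP (s + d) a) => sda'; first by far [:: (s + d)%N; 0].
by far [:: (s + d - a)%N; (s + d - a).+1].
Qed.

Lemma near_succ (r s : 'I_a) : (r != 0 :> nat) -> (r != k :> nat) ->
  (s != 0 :> nat) -> (s != k :> nat) -> s = r.+1 :> nat -> near famo 1 r s.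
Proof.
by move=> r0 rk s0 sk rs; have := ltn_ord r; have := ltn_ord s => sa ra; near1 r.
Qed.

Lemma near_pred (r s : 'I_a) : (r != 0 :> nat) -> (r != k :> nat) ->
  (s != 0 :> nat) -> (s != k :> nat) -> r = s.+1 :> nat -> near famo 1 r s.
Proof.
move=> r0 rk s0 sk rs; have := ltn_ord r; have := ltn_ord s => sa ra.
by case: (ltnP (s + d) a) => sda; [near1 (s + d)%N|near1 (s + d - a)%N].
Qed.

End FamilyFar.

(* For [k = 3] and [q = d + 1], the relation [near 1] consists of the triangle 0,1,2, the isolated
   row 3 and the path 4,...,a-1. *)
Section Dense.
Variables (a d : nat).
Hypotheses (d_ge4 : (4 <= d)%N) (le_da : (2 * d <= a)%N).

Local Notation famd := (fam a d 3 d.+1).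
Local Notation famo := (fun i j : 'I_a => famd i j).

Let pt_lt i : (i < 8)%N -> (i < a)%N. Proof. lia. Qed.
Local Notation o i := (Ordinal (pt_lt (isT : (i < 8)%N))).
Let lt_da : (d.+2 <= a)%N. Proof. lia. Qed.
Let d_ge2 : (2 <= d)%N. Proof. lia. Qed.

Lemma dense_isolated (s : 'I_a) : near famo 1 (o 3) s -> s = o 3.
Proof.
have := ltn_ord s => sa near_s; apply: val_inj; apply/eqP => /=; apply: contraT => s3.
exfalso; move: near_s; case: (ltnP s 4) => s4.
  have [s0|s12] : s = 0 :> nat \/ s = 1 :> nat \/ s = 2 :> nat by lia.
    by far [:: 0; d].
  by far [:: 0; d.+2].
case: (leqP (s + d) a) => sda; first by far [:: 0; 3].
by case: (ltnP d.+2 s) => ds; [far [:: d; d.+2]|far [:: 3; d]].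
Qed.

Lemma dense_two_near (r : 'I_a) : r != 3 :> nat -> r != 4 :> nat -> r.+1 != a ->
  exists s s' : 'I_a, [/\ uniq [:: r; s; s'], near famo 1 r s & near famo 1 r s'].
Proof.
move=> r3 r4 ra1; have := ltn_ord r => ra; case: (ltnP r 4) => lt_r4.
  have [|[|]] : r = 0 :> nat \/ r = 1 :> nat \/ r = 2 :> nat by lia.
  - move=> r0; exists (o 1), (o 2); split; first by rewrite /= !inE -!val_eqE /=; lia.
      by near1 d.+1.
    by near1 1.
  - move=> r1; exists (o 0), (o 2); split; first by rewrite /= !inE -!val_eqE /=; lia.
      by near1 d.
    by near1 1.
  move=> r2; exists (o 0), (o 1); split; first by rewrite /= !inE -!val_eqE /=; lia.
    by near1 d.
  by near1 d.+1.
have p_lt : (r.-1 < a)%N by lia. have s_lt : (r.+1 < a)%N by lia.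
exists (Ordinal p_lt), (Ordinal s_lt); split; first by rewrite /= !inE -!val_eqE /=; lia.
  by apply: near_pred => /=; lia.
by apply: near_succ => /=; lia.
Qed.

Lemma dense_near (r : 'I_a) : r != o 3 -> exists2 s : 'I_a, s != r & near famo 1 r s.
Proof.
rewrite -val_eqE /= => r3; have := ltn_ord r => ra.
case: (eqVneq r.+1 a) => ra1.
  have p_lt : (r.-1 < a)%N by lia.
  by exists (Ordinal p_lt); [rewrite -val_eqE /=; lia|apply: near_pred => /=; lia].
case: (eqVneq (r : nat) 4) => r4.
  by exists (o 5); [rewrite -val_eqE /= r4|apply: near_succ => /=; lia].
have [s [s' [us near_s _]]] := dense_two_near r3 r4 ra1; exists s => //.
by move: us; rewrite /= !inE negb_or eq_sym => /andP[/andP[]].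
Qed.

(** The alternative [s = 3] is left open here: along the path it is ruled out because row 3 is
    fixed. *)
Lemma dense_path (r s : 'I_a) : (4 <= r)%N -> r.+1 != a -> near famo 1 r s ->
  s = 3 :> nat \/ (r <= s.+1)%N /\ (s <= r.+1)%N.
Proof.
move=> r4 ra1 near_rs; have := ltn_ord r => ra; have := ltn_ord s => sa.
case: (eqVneq (s : nat) 3) => [|s3]; [by left|right].
case: (eqVneq (s : nat) 0) => s0.
  exfalso; move: near_rs; case: (ltnP d.+1 r) => dr; first by far [:: r : nat; r.+1].
  by case: (leqP r d) => rd; [far [:: d; d.+2]|far [:: d.+2; d.+3]].
case: (leqP r s.+1) => rs; case: (leqP s r.+1) => sr //; exfalso; move: near_rs;
  by apply: circ_far => //; lia.
Qed.

Lemma dense_start (s : 'I_a) : near famo 1 (o 4) s -> s = o 4 \/ s = o 5.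
Proof.
move=> near_s; have s3 : s != 3 :> nat.
  by apply/eqP => s3; move: near_s; far [:: d.+1; d.+3].
have [|/= s_3|/= s45] := dense_path (r := o 4) (leqnn 4) _ near_s; [by move=> /=; lia|by rewrite s_3 in s3|].
by case: (eqVneq (s : nat) 4) => s4; [left|right]; apply: val_inj => /=; lia.
Qed.

(** For [c > 3], row [c + 1] contains [c'] but not [c] if [c' <= c + d], and otherwise row [c]
    contains [c] but not [c']. The columns up to 3 are affected by the switch or the wrap-around and
    get their own rows. *)
Lemma dense_cols (c c' : 'I_a) : (c < c')%N -> exists r : 'I_a, famd r c != famd r c'.
Proof.
move=> cc'; have := ltn_ord c' => c'a.
case: (ltnP 3 c) => c3.
  case: (leqP c' (c + d)) => cd; last by exists c; fam_lia.
  have c1a : (c.+1 < a)%N by lia.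
  by exists (Ordinal c1a); fam_lia.
case: (eqVneq (c : nat) 0) => c0.
  case: (leqP c' d) => c'd; first by exists (o 1); fam_lia.
  by case: (eqVneq (c' : nat) d.+2) => c'd2; [exists (o 4)|exists (o 3)]; fam_lia.
case: (eqVneq (c : nat) 3) => c_3.
  by case: (leqP c' d.+3) => c'd; [exists (o 4)|exists (o 3)]; fam_lia.
case: (eqVneq (c : nat) 1) => c_1.
  by case: (leqP c' d.+1) => c'd; [exists (o 2)|exists (o 1)]; fam_lia.
by case: (leqP c' d) => c'd; [exists (o 3)|exists (o 1)]; fam_lia.
Qed.

Lemma dense_asym : asym famo.
Proof.
move=> u v uv.
have u3 : u (o 3) = o 3 := aut_isolated uv dense_isolated dense_near.
(* The image of row 4 must be an end of the path, and row 3 exceeds row 4 by two columns but row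
   [a - 1] by at least three. *)
have u4 : u (o 4) = o 4.
  apply: val_inj; apply/eqP; apply: contraT => u4.
  have u43 : u (o 4) != 3 :> nat by apply/eqP => /(@perm_fix_val _ u _ (o 3) u3).
  case: (eqVneq (u (o 4)).+1 a) => ra.
    exfalso; have : near famo 2 (u (o 3)) (u (o 4)) by apply: near_aut uv _; near2 0 3.
    by rewrite u3; far [:: d.-1; d; d.+2].
  have [s [s' [us near_s near_s']]] := dense_two_near u43 u4 ra.
  by have := aut_end uv dense_start us near_s near_s'.
(* The image of [r] is near the fixed row [r - 1], and all candidates other than [r] are fixed rows
   already. *)
have upath (r : 'I_a) : (4 <= r)%N -> u r = r.
  case: r => r ra /=; elim/ltn_ind: r ra => r IH ra r4.
  case: (eqVneq r 4) => r_4; first by rewrite (_ : Ordinal ra = o 4) //; apply: val_inj.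
  have pa : (r.-1 < a)%N by lia. pose p := Ordinal pa.
  have up : u p = p by apply: IH; lia.
  have near_p : near famo 1 p (u (Ordinal ra)).
    by rewrite -{1}up; apply: near_aut uv _; apply: near_succ => /=; lia.
  apply: val_inj; have [||/(@perm_fix_val _ u _ (o 3) u3)|[ps sp]] := dense_path _ _ near_p => /=; try lia.
  have [//|[s_p|s_pp]] : u (Ordinal ra) = r :> nat \/ u (Ordinal ra) = r.-1 :> nat \/ u (Ordinal ra) = r.-2 :> nat.
  - by move: ps sp => /=; lia.
  - by have /= := @perm_fix_val _ u _ p up s_p; lia.
  have ppa : (r.-2 < a)%N by lia.
  have upp : u (Ordinal ppa) = Ordinal ppa.
    case: (eqVneq r 5) => r5; last by apply: IH; lia.
    by rewrite (_ : Ordinal ppa = o 3) //; apply: val_inj; rewrite /= r5.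
  by have /= := @perm_fix_val _ u _ _ upp s_pp; lia.
have fix3 (r : 'I_a) : (3 <= r)%N -> u r = r.
  case: (eqVneq (r : nat) 3) => [r3 _|r3 r_ge3]; last by apply: upath; lia.
  by rewrite (_ : r = o 3) //; apply: val_inj.
have small (r : 'I_a) : (r < 3)%N -> (u r < 3)%N.
  by move=> r3; case: (ltnP (u r) 3) => // ur; have := @perm_fix_val _ u r _ (fix3 _ ur) erefl; lia.
(* Inside the triangle, row 4 exceeds row 2 by two columns but rows 0 and 1 by three; likewise row 3
   exceeds row 1 by two columns but row 0 by three. *)
have u2 : u (o 2) = o 2.
  have := small (o 2) isT; have : near famo 2 (o 4) (u (o 2)).
    by rewrite -{1}u4; apply: near_aut uv _; near2 d.+2 d.+3.
  move=> near_u2 lt3; apply: val_inj => /=; apply/eqP; apply: contraT => u2; exfalso; move: near_u2.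
  by case: (eqVneq (u (o 2) : nat) 0) => u20; [far [:: d; d.+2; d.+3]|far [:: d.+1; d.+2; d.+3]].
have u1 : u (o 1) = o 1.
  have := small (o 1) isT; have : near famo 2 (o 3) (u (o 1)).
    by rewrite -{1}u3; apply: near_aut uv _; near2 0 d.+2.
  move=> near_u1 lt3; apply: val_inj => /=; apply/eqP; apply: contraT => u1; exfalso; move: near_u1.
  case: (eqVneq (u (o 1) : nat) 2) => [/(@perm_fix_val _ u _ (o 2) u2) //|u12].
  by far [:: 0; d; d.+2].
have u_id r : u r = r.
  case: (ltnP 2 r) => r2; first exact: fix3.
  case: (eqVneq (r : nat) 2) => r_2; first by rewrite (_ : r = o 2) //; apply: val_inj.
  case: (eqVneq (r : nat) 1) => r_1; first by rewrite (_ : r = o 1) //; apply: val_inj.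
  have ur_lt := small r r2; apply: val_inj => /=.
  case: (eqVneq (u r : nat) 2) => [/(@perm_fix_val _ u _ (o 2) u2) /= |u_2]; first lia.
  case: (eqVneq (u r : nat) 1) => [/(@perm_fix_val _ u _ (o 1) u1) /= |u_1]; first lia.
  lia.
have u1' : u = 1%g by apply/permP => i; rewrite perm1.
by split=> //; apply: aut_cols uv u1' _; apply: dense_cols.
Qed.

End Dense.

(* For [d = 3], [k = 4] and [q = 5], the relation [near 1] consists of the paths 0,1,2,3 and
   5,...,a-1 and the isolated row 4. *)
Section Cubic.
Variable a : nat.
Hypothesis a_ge9 : (9 <= a)%N.
Local Notation famc := (fam a 3 4 5).
Local Notation famo := (fun i j : 'I_a => famc i j).

Let pt_lt i : (i < 9)%N -> (i < a)%N. Proof. lia. Qed.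
Local Notation o i := (Ordinal (pt_lt (isT : (i < 9)%N))).

Lemma cubic_far (r s : 'I_a) : r != 0 :> nat -> r != 4 :> nat -> s != 4 :> nat ->
  (r.+1 < s)%N -> ~ near famo 1 r s.
Proof. by move=> r0 r4 s4 rs; apply: circ_far => //; lia. Qed.

Lemma cubic_isolated (s : 'I_a) : near famo 1 (o 4) s -> s = o 4.
Proof.
have := ltn_ord s => sa near_s; apply: val_inj; apply/eqP => /=; apply: contraT => s4.
exfalso; move: near_s; case: (ltnP s 7) => s7; last by far [:: 4; 6].
have [s056|s123] : (s = 0 :> nat \/ s = 5 :> nat \/ s = 6 :> nat) \/
  (s = 1 :> nat \/ s = 2 :> nat \/ s = 3 :> nat) by lia.
  by far [:: 0; 4].
by far [:: 0; 6].
Qed.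

Lemma cubic_two_near (r : 'I_a) : r != 0 :> nat -> r != 3 :> nat -> r != 4 :> nat ->
  r != 5 :> nat -> r.+1 != a ->
  exists s s' : 'I_a, [/\ uniq [:: r; s; s'], near famo 1 r s & near famo 1 r s'].
Proof.
move=> r0 r3 r4 r5 ra1; have := ltn_ord r => ra.
have p_lt : (r.-1 < a)%N by lia. have s_lt : (r.+1 < a)%N by lia.
exists (Ordinal p_lt), (Ordinal s_lt); split; first by rewrite /= !inE -!val_eqE /=; lia.
  case: (eqVneq (r : nat) 1) => r1; first by near1 3.
  by apply: near_pred => /=; lia.
by apply: near_succ => /=; lia.
Qed.

Lemma cubic_near (r : 'I_a) : r != o 4 -> exists2 s : 'I_a, s != r & near famo 1 r s.
Proof.
rewrite -val_eqE /= => r4; have := ltn_ord r => ra.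
case: (ltnP r 2) => r2.
  have s_lt : (r.+1 < a)%N by lia.
  exists (Ordinal s_lt); first by rewrite -val_eqE /=; lia.
  by case: (eqVneq (r : nat) 0) => r0; [near1 5|near1 1].
case: (eqVneq (r : nat) 5) => r5.
  by exists (o 6); [rewrite -val_eqE /= r5|apply: near_succ => /=; lia].
have p_lt : (r.-1 < a)%N by lia.
by exists (Ordinal p_lt); [rewrite -val_eqE /=; lia|apply: near_pred => /=; lia].
Qed.

Lemma cubic_start (s : 'I_a) : near famo 1 (o 0) s -> s = o 0 \/ s = o 1.
Proof.
have := ltn_ord s => sa near_s; case: (eqVneq (s : nat) 0) => s0; first by left; apply: val_inj.
right; apply: val_inj; apply/eqP => /=; apply: contraT => s1; exfalso; move: near_s.
case: (ltnP 5 s) => s5; first by far [:: 2; 5].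
by case: (eqVneq (s : nat) 2) => s2; [far [:: 1; 5]|far [:: 1; 2]].
Qed.

Lemma cubic_cols (c c' : 'I_a) : (c < c')%N -> exists r : 'I_a, famc r c != famc r c'.
Proof.
move=> cc'; have := ltn_ord c' => c'a.
case: (ltnP 4 c) => c4.
  case: (leqP c' (c + 2)) => cd; last by exists c; fam_lia.
  have c1a : (c.+1 < a)%N by lia.
  by exists (Ordinal c1a); fam_lia.
case: (eqVneq (c : nat) 4) => c_4; first by exists (o 2); fam_lia.
case: (eqVneq (c : nat) 3) => c_3; first by exists (o 1); fam_lia.
case: (eqVneq (c : nat) 2) => c_2.
  by case: (leqP c' 5) => c'd; [exists (o 3)|exists (o 2)]; fam_lia.
case: (eqVneq (c : nat) 1) => c_1.
  by case: (leqP c' 4) => c'd; [exists (o 2)|exists (o 1)]; fam_lia.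
case: (leqP c' 3) => c'3; first by exists (o 1); fam_lia.
case: (leqP c' 5) => c'5; first by exists (o 3); fam_lia.
by case: (leqP c' 6) => c'6; [exists (o 5)|exists (o 4)]; fam_lia.
Qed.

Lemma cubic_asym : asym famo.
Proof.
move=> u v uv.
have u4 : u (o 4) = o 4 := aut_isolated uv cubic_isolated cubic_near.
(* The image of row 0 is an end of one of the paths. Row 4 is disjoint from row 0 but meets the
   other ends 3, 5 and [a - 1]. *)
have u0 : u (o 0) = o 0.
  apply: val_inj; apply/eqP; apply: contraT => u0; exfalso.
  have u04 : u (o 0) != 4 :> nat by apply/eqP => /(@perm_fix_val _ u _ (o 4) u4).
  have not_near : ~ near famo 2 (o 4) (u (o 0)).
    rewrite -{1}u4 => /(near_autE _ _ _ uv); rewrite permK.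
    by far [:: 0; 4; 6].
  have := ltn_ord (u (o 0)) => ua.
  case: (eqVneq (u (o 0) : nat) 3) => u03; first by apply: not_near; near2 0 6.
  case: (eqVneq (u (o 0) : nat) 5) => u05; first by apply: not_near; near2 0 4.
  case: (eqVneq (u (o 0)).+1 a) => u0a; first by apply: not_near; near2 4 6.
  have [s [s' [us near_s near_s']]] := cubic_two_near u0 u03 u04 u05 u0a.
  by have := aut_end uv cubic_start us near_s near_s'.
have u_id (r : 'I_a) : u r = r.
  case: r => r ra; elim/ltn_ind: r ra => r IH ra.
  case: (eqVneq r 0) => r0; first by rewrite (_ : Ordinal ra = o 0) //; apply: val_inj.
  case: (eqVneq r 4) => r4; first by rewrite (_ : Ordinal ra = o 4) //; apply: val_inj.
  apply: perm_fix_le => [[j ja] /= jr|]; first exact: IH.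
  rewrite leqNgt; apply/negP => ltu; have := ltn_ord (u (Ordinal ra)) => ua.
  (* Row 5 begins the second path; among the rows from 5 on it alone meets row 3. *)
  case: (eqVneq r 5) => r5.
    have : near famo 2 (u (o 3)) (u (Ordinal ra)) by apply: near_aut uv _; near2 3 4.
    by rewrite (IH 3) ?r5 //; move: ltu => /= ltu; far [:: 3; 4; 5].
  have pa : (r.-1 < a)%N by lia. pose p := Ordinal pa.
  have up : u p = p by apply: IH; lia.
  have u_4 : u (Ordinal ra) != 4 :> nat.
    by apply/eqP => /(@perm_fix_val _ u _ (o 4) u4) /= r_4; rewrite r_4 in r4.
  have near_p : near famo 1 (u p) (u (Ordinal ra)).
    apply: near_aut uv _; case: (eqVneq r 1) => r1; first by near1 5.
    by apply: near_succ => /=; lia.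
  rewrite up in near_p; case: (eqVneq r 1) => r1.
    have [] := @cubic_start (u (Ordinal ra)).
    - by rewrite (_ : o 0 = p) //; apply: val_inj; rewrite /= r1.
    - by move/(congr1 val) => /=; move: ltu => /=; lia.
    - by move/(congr1 val) => /=; move: ltu => /=; lia.
  by move: ltu => /= ltu; move: near_p; apply: cubic_far => //=; lia.
have u1 : u = 1%g by apply/permP => i; rewrite perm1.
by split=> //; apply: aut_cols uv u1 _; apply: cubic_cols.
Qed.

End Cubic.

Lemma ex_asym_half a d : (8 <= a)%N -> (3 <= d)%N -> (2 * d <= a)%N ->
  exists2 e : rel 'I_a, regular d e & asym e.
Proof.
move=> a8 d3 da; case: (ltnP 3 d) => d4.
  exists (fun i j => fam a d 3 d.+1 i j); last exact: dense_asym.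
  by apply: fam_regular; lia.
have -> : d = 3 by lia.
case: (ltnP 8 a) => a9; last by have -> : a = 8 by [lia]; apply: ex_asym8.
exists (fun i j => fam a 3 4 5 i j); last exact: cubic_asym.
by apply: fam_regular; lia.
Qed.

Lemma ex_asym a d : (8 <= a)%N -> (3 <= d)%N -> (d + 3 <= a)%N ->
  exists2 e : rel 'I_a, regular d e & asym e.
Proof.
move=> a8 d3 da; case: (leqP (2 * d) a) => da2; first exact: ex_asym_half.
have [| |e re ase] := @ex_asym_half a (a - d) a8; try lia.
exists (fun i j => ~~ e i j); last exact: asym_compl.
by rewrite -[d](subKn (_ : d <= a)%N); [apply: regular_compl|lia].
Qed.


(** * Lower bounds and assembly of the cases *)

Lemma not_rigid1 (T : finType) a b (f : T -> 'I_a) :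
  (0 < a)%N -> (1 < b)%N -> balanced b f -> ~ rigid [:: f].
Proof.
move=> a_gt0 b_gt1 bf rig.
have /card_gt1P[x [y [fx fy xy]]] : (1 < #|[set x | f x == Ordinal a_gt0]|)%N by rewrite bf.
have : tperm x y = 1%g.
  apply: rig; split=> //; exists 1%g => z; rewrite perm1.
  by move: fx fy; rewrite !inE => /eqP fx /eqP fy; case: tpermP => [->|->|]; rewrite ?fx ?fy.
by move/permP/(_ x); rewrite tpermL perm1 => /esym/eqP; rewrite (negPf xy).
Qed.

Lemma not_rigid2 (T : finType) a b (f1 f2 : T -> 'I_a) :
  (3 <= b <= a)%N -> ~~ (maxn (b + 3) 8 <= a)%N -> balanced b f1 -> balanced b f2 ->
  ~ rigid [:: f1; f2].
Proof.
move=> /andP[b3 ba] small b1 b2 rig.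
have [e reg ase] := rigid2_asym (ltnW (ltnW b3)) b1 b2 rig.
have [reg' ase'] := (regular_compl reg, asym_compl ase).
(* If [a - b >= 3], then [a < 8], so [a] is 6 or 7 and one of [b] and [a - b] equals 3. *)
have [ab|[ab|[ab|ab]]] : (a - b = 0 \/ a - b = 1 \/ a - b = 2 \/
  (b = 3 \/ a - b = 3) /\ (a = 6 \/ a = 7))%N by lia.
- by rewrite ab in reg'; apply: not_asym0 reg' ase'; lia.
- by rewrite ab in reg'; apply: not_asym1 reg' ase'; lia.
- by rewrite ab in reg'; apply: not_asym2 reg' ase'; lia.
case: ab => -[ab|ab] a67; last by rewrite ab in reg'; apply: not_asym3 a67 reg' ase'.
by rewrite ab in reg; apply: not_asym3 a67 reg ase.
Qed.

Theorem theorem2 (a b : nat) :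
  (2 <= b)%N -> (b <= a)%N -> (a, b) <> (2, 2) ->
  base_size [set: {perm 'I_(a * b)}] (wreath_stab a b) =
    (if (a == 3) && (b == 2) then 4
     else if (3 <= b) && (maxn (b + 3) 8 <= a) then 2
     else 3)%N.
Proof.
move=> b2 ba ab22; have b_gt0 : (0 < b)%N by apply: ltnW.
(* The default value [(ab)!] of the minimum must exceed the excluded sizes, which are at most 3. *)
have fact_gt : (3 < (a * b)`!)%N.
  apply: leq_trans (fact_geq _); suff : (3 <= a)%N by nia.
  by rewrite leqNgt; apply/negP => a3; apply: ab22; congr pair; lia.
apply/eqP; rewrite eqn_leq; case: (leqP 3 b) => [b3|b3].
  (* The grid family gives the upper bound 3 when it is needed, and makes the core trivial for both
     lower bounds. *)
  have [fs [szfs bfs rfs]] := ex_rigid_grid (introT andP (conj b3 ba)).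
  have cardT : #|{: 'I_a * 'I_b}| = (a * b)%N by rewrite card_prod !card_ord.
  have -> : (b == 2) = false by apply/eqP; lia.
  rewrite andbF /=; case: ifP => [large|/negbT small].
    have [e reg ase] : exists2 e : rel 'I_a, regular b e & asym e by apply: ex_asym; lia.
    have [bf bs] := (efst_balanced reg, esnd_balanced reg).
    apply/andP; split.
      apply: (@base_size_le_rigid _ _ _ [:: @efst _ e; @esnd _ e]) => //.
        by rewrite (balanced_card bf).
      by apply/(edge_rigid b_gt0 reg).
    apply: (base_size_gt_rigid b_gt0 cardT bfs rfs); first by lia.
    case=> [|f []] // _ [bF _]; apply: not_rigid1 bF; lia.
  rewrite -{1}szfs base_size_le_rigid //=.
  apply: (base_size_gt_rigid b_gt0 cardT bfs rfs); first by lia.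
  case=> [|f1 [|f2 []]] // _ [bF1 [bF2 _]]; apply: not_rigid2 bF1 bF2 => //.
  by rewrite b3.
have bE : b = 2 by lia.
subst b; rewrite andbT /=; case: (eqVneq a 3) => [a3|a_neq3].
  subst a; have [fs [szfs bfs rfs]] := ex_rigid_label6.
  have cardT : #|'I_6| = (3 * 2)%N by rewrite card_ord.
  rewrite -{1}szfs base_size_le_rigid //=.
  apply: (base_size_gt_rigid b_gt0 cardT bfs rfs) => //.
  case=> [|f1 [|f2 [|f3 []]]] // _ [bF1 [bF2 [bF3 _]]].
  exact: not_rigid6.
have a_neq2 : a != 2 by apply/eqP => a2; apply: ab22; rewrite a2.
have a4 : (4 <= a)%N by lia.
have [fs [szfs bfs rfs]] := ex_rigid_matchings a4.
have cardT : #|'I_(a * 2)| = (a * 2)%N by rewrite card_ord.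
rewrite -{1}szfs base_size_le_rigid //=.
apply: (base_size_gt_rigid b_gt0 cardT bfs rfs); first by lia.
case=> [|f1 [|f2 []]] // _ [bF1 [bF2 _]].
by apply: not_rigid22 bF1 bF2; lia.
Qed.
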